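(* Let $H\ge1$ be a fixed integer and let $(p_n)$ be an arbitrary sequence of positive integers with $p_n\to+\infty$. Let $\mathbf{X}_{nt}$, $t=1,\ldots,n$, $n=1,2,\ldots$, be a triangular array such that, for each $n$, the random $p_n$-vectors $\mathbf{X}_{n1},\ldots,\mathbf{X}_{nn}$ are i.i.d. with a common distribution that has spherical directions. Let $\mathbf{U}_{nt}=\mathbf{X}_{nt}/\|\mathbf{X}_{nt}\|$, and $$T_n=\sum_{h=1}^H (n-h)\|\mathbf{r}(h)\|_{\rm Fr}^2,\qquad \mathbf{r}(h)=\frac{p_n}{n-h}\sum_{t=h+1}^n\mathbf{U}_{nt}\mathbf{U}_{n,t-h}'.$$ Then $$T_n^{\rm St}=\frac{T_n-Hp_n^2}{\sqrt{2Hp_n^2}}=\frac{\sqrt{2p_n^2}}{\sqrt H}\sum_{h=1}^H\frac{1}{n-h}\sum_{h+1\le s<t\le n}(\mathbf{U}_{n,s-h}'\mathbf{U}_{n,t-h})(\mathbf{U}_{ns}'\mathbf{U}_{nt})$$ converges in distribution to the standard normal distribution as $n\to\infty$.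
   Context: A distribution on $\mathbb{R}^p$ has spherical directions if it puts no mass at the origin and, for $\mathbf{X}$ with this distribution, $\mathbf{X}/\|\mathbf{X}\|$ is uniformly distributed on the unit sphere $\mathcal{S}^{p-1}$. $\|\mathbf{A}\|_{\rm Fr}=({\rm Trace}(\mathbf{A}\mathbf{A}'))^{1/2}$ is the Frobenius norm. *)

(* Defs.v *)
From HB Require Import structures.
From mathcomp Require Import all_boot all_order all_algebra.
From mathcomp Require Import all_classical all_reals all_analysis.
From mathcomp Require Import normal_distribution.

Set Implicit Arguments.
Unset Strict Implicit.
Unset Printing Implicit Defensive.

Import Order.TTheory GRing.Theory Num.Theory.
Import numFieldNormedType.Exports.

Local Open Scope classical_set_scope.
Local Open Scope ring_scope.

Section defs.
Variable R : realType.

Definition vnorm (p : nat) (v : 'cV[R]_p) : R := Num.sqrt (\sum_i (v i ord0) ^+ 2).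

Definition frob (p : nat) (A : 'M[R]_p) : R := Num.sqrt (\tr (A *m A^T)).

Definition udir (p : nat) (v : 'cV[R]_p) : 'cV[R]_p := (vnorm v)^-1 *: v.

Definition vborel (p : nat) : set (set 'cV[R]_p) :=
  <<s [set E | exists (i : 'I_p) (A : set R),
          measurable A /\ E = [set v : 'cV[R]_p | A (v i ord0)]] >>.

Definition orthogonal_mx (p : nat) (O : 'M[R]_p) : Prop := O^T *m O = 1%:M.

Variables (d : measure_display) (T : measurableType d) (P : probability T R).

Definition random_vector (p : nat) (X : T -> 'cV[R]_p) : Prop :=
  forall B, vborel B -> measurable (X @^-1` B).

(* The distribution of X has spherical directions: no mass at the origin, and
   X/||X|| is uniform on the unit sphere, i.e. its law is the (unique)
   orthogonally invariant probability on S^{p-1}. *)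
Definition spherical_directions (p : nat) (X : T -> 'cV[R]_p) : Prop :=
  P (X @^-1` [set 0]) = 0%E /\
  forall (O : 'M[R]_p) (B : set 'cV[R]_p), orthogonal_mx O -> vborel B ->
    P ((fun w => udir (X w)) @^-1` B) =
    P ((fun w => O *m udir (X w)) @^-1` B).

Definition iid_vectors (p n : nat) (X : nat -> T -> 'cV[R]_p) : Prop :=
  (forall t, (1 <= t <= n)%N -> random_vector (X t)) /\
  (forall B : nat -> set 'cV[R]_p, (forall t, vborel (B t)) ->
     P (\bigcap_(t in [set t | (1 <= t <= n)%N]) (X t @^-1` B t)) =
     (\prod_(1 <= t < n.+1) P (X t @^-1` B t))%E) /\
  (forall t B, (1 <= t <= n)%N -> vborel B ->
     P (X t @^-1` B) = P (X 1%N @^-1` B)).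

End defs.

Section stat.
Variable R : realType.

Definition rmat (p n h : nat) (U : nat -> 'cV[R]_p) : 'M[R]_p :=
  (p%:R / (n - h)%:R) *: \sum_(h.+1 <= t < n.+1) (U t *m (U (t - h)%N)^T).

Definition Tstat (H p n : nat) (U : nat -> 'cV[R]_p) : R :=
  \sum_(1 <= h < H.+1) (n - h)%:R * frob (rmat n h U) ^+ 2.

Definition TStat (H p n : nat) (U : nat -> 'cV[R]_p) : R :=
  (Tstat H n U - H%:R * p%:R ^+ 2) / Num.sqrt (2 * H%:R * p%:R ^+ 2).

Definition TStat_alt (H p n : nat) (U : nat -> 'cV[R]_p) : R :=
  Num.sqrt (2 * p%:R ^+ 2) / Num.sqrt H%:R *
  \sum_(1 <= h < H.+1) ((n - h)%:R)^-1 *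
    \sum_(h.+1 <= t < n.+1) \sum_(h.+1 <= s < t)
       (((U (s - h)%N)^T *m U (t - h)%N) ord0 ord0 * ((U s)^T *m U t) ord0 ord0).

End stat.

(* Main.v *)
Require Import Defs.
From HB Require Import structures.
From mathcomp Require Import all_boot all_order all_algebra.
From mathcomp Require Import all_classical all_reals all_analysis.
From mathcomp Require Import measurable_realfun normal_distribution.
From mathcomp Require Import ring lra zify.

Set Implicit Arguments.
Unset Strict Implicit.
Unset Printing Implicit Defensive.

Import Order.TTheory GRing.Theory Num.Theory.
Import numFieldNormedType.Exports.

Local Open Scope classical_set_scope.
Local Open Scope ring_scope.

(** Off a null event the standardized statistic is a sum of increments
    xi_t = c (U_t . Y_t), where Y_t is a function of U_1, ..., U_(t-1); they are
    martingale differences, since the law of U_t is symmetric.  The conditional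
    variance of xi_t is a multiple of |Y_t|^2, a quadratic form in inner products
    of the U_s.  Its off-diagonal terms are pairwise orthogonal, because flipping
    the sign of a single U_v changes the sign of their product, and their second
    moments are O(p^-3).  Hence, as p tends to infinity, every single conditional
    variance concentrates around a deterministic value tau_t, and the tau_t sum to
    1 + O(1/n).  So no random time change is needed: Lindeberg's telescoping is
    applied to u(s, x) = Phi((a - x) / sqrt s), a solution of the heat equation,
    along the deterministic times s = s0 + sum_(r > t) tau_r.  At the final time s0
    this function is a smoothed indicator, and s0 -> 0 yields the limit of the
    distribution functions. *)

(** * Expectations of bounded measurable functions *)

(** No conditional expectation is formed. Replacing row [v] by an independent copy preserves the law
    of the array, so conditioning on the other rows becomes an inner integral over row [v], and
    predictability becomes the pointwise statement that a function ignores that row ([free]). The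
    sizes of n and p are unrelated, which decides how much concentration is required. Each of the n
    telescoping steps pays the L1 distance between the conditional variance and tau_t, so this
    distance must be o(1/n). Its square is O(n^-4 (n + n^2/p)): the part n comes from diagonal terms
    and fourth moments, the part n^2/p from off-diagonal terms and sixth moments. All n steps
    together then cost O(sqrt(1/n + 1/p)). Third absolute moments of the increments are not computed
    but interpolated between second and fourth moments with a free weight eta. The parameters are
    fixed in the order zeta (a shift of the threshold), s0, eta, and only then n and p. At the
    origin [udir] is not a unit vector; a modification on a null set makes the algebraic identities
    hold at every point. *)

Section bounded_measurable.
Context d (T : measurableType d) (R : realType).
Implicit Types (F G : T -> R).

(** Everything integrated below is built from inner products of unit vectors or from bounded
    functions of them, so boundedness replaces integrability arguments. The bound holds at every
    point rather than almost everywhere, hence survives fixing one variable in Fubini and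
    substituting a row. *)
Definition bmf F := measurable_fun setT F /\ exists M, forall x, `|F x| <= M.

Lemma bmf_cst (c : R) : bmf (fun=> c).
Proof. by split; [exact: measurable_cst | exists `|c|]. Qed.

Lemma bmfD F G : bmf F -> bmf G -> bmf (fun x => F x + G x).
Proof.
move=> [mF [M hM]] [mG [N hN]]; split; first exact: measurable_funD.
by exists (M + N) => x; apply: (le_trans (ler_normD _ _)); exact: lerD.
Qed.

Lemma bmfM F G : bmf F -> bmf G -> bmf (fun x => F x * G x).
Proof.
move=> [mF [M hM]] [mG [N hN]]; split; first exact: measurable_funM.
by exists (M * N) => x; rewrite normrM; exact: ler_pM.
Qed.

Lemma bmfZ c F : bmf F -> bmf (fun x => c * F x).
Proof. by apply: bmfM; exact: bmf_cst. Qed.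

Lemma bmfN F : bmf F -> bmf (fun x => - F x).
Proof.
move=> bF; have := bmfZ (-1) bF.
by congr bmf; apply/funext => x; rewrite mulN1r.
Qed.

Lemma bmfB F G : bmf F -> bmf G -> bmf (fun x => F x - G x).
Proof. by move=> bF bG; apply: bmfD => //; exact: bmfN. Qed.

Lemma bmfX k F : bmf F -> bmf (fun x => F x ^+ k).
Proof.
move=> bF; elim: k => [|k IH]; first exact: bmf_cst.
have := bmfM bF IH.
by congr bmf; apply/funext => x; rewrite exprS.
Qed.

Lemma bmf_sum (I : Type) (s : seq I) (Pr : pred I) (F : I -> T -> R) :
  (forall i, Pr i -> bmf (F i)) -> bmf (fun x => \sum_(i <- s | Pr i) F i x).
Proof.
move=> bF; elim: s => [|i s IH].
  by under eq_fun do rewrite big_nil; exact: bmf_cst.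
have [Pi|Pi] := boolP (Pr i).
  by under eq_fun do rewrite big_cons Pi; apply: bmfD => //; exact: bF.
by under eq_fun do rewrite big_cons (negPf Pi).
Qed.

Lemma bmf_comp (g : R -> R) F :
  measurable_fun setT g -> (exists M, forall y, `|g y| <= M) ->
  measurable_fun setT F -> bmf (fun x => g (F x)).
Proof.
move=> mg [M hM] mF; split; last by exists M.
exact: (measurableT_comp mg mF).
Qed.

Lemma bmf_norm F : bmf F -> bmf (fun x => `|F x|).
Proof.
move=> [mF [M hM]]; split; last by exists M => x; rewrite normr_id.
exact: (measurableT_comp (@normr_measurable R setT) mF).
Qed.

Variable P : probability T R.

Lemma bmf_integrable F : bmf F -> P.-integrable setT (EFin \o F).
Proof.
move=> [mF [M hM]]; apply: measurable_bounded_integrable => //.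
  by rewrite -ge0_fin_numE// fin_num_measure.
exists M; split; first exact: num_real.
by move=> N MN x _ /=; apply: (le_trans (hM x)); exact: ltW.
Qed.

Lemma meanD F G : bmf F -> bmf G ->
  \int[P]_x (F x + G x) = \int[P]_x F x + \int[P]_x G x.
Proof. by move=> bF bG; apply: RintegralD => //; exact: bmf_integrable. Qed.

Lemma meanB F G : bmf F -> bmf G ->
  \int[P]_x (F x - G x) = \int[P]_x F x - \int[P]_x G x.
Proof. by move=> bF bG; apply: RintegralB => //; exact: bmf_integrable. Qed.

Lemma meanZ c F : bmf F -> \int[P]_x (c * F x) = c * \int[P]_x F x.
Proof. by move=> bF; apply: RintegralZl => //; exact: bmf_integrable. Qed.

Lemma mean_cst c : \int[P]_x c = c.
Proof.
by rewrite Rintegral_cst// [X in _ * fine X](_ : _ = 1%E) ?mulr1//; exact: probability_setT.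
Qed.

Lemma mean_sum (I : Type) (s : seq I) (Pr : pred I) (F : I -> T -> R) :
  (forall i, Pr i -> bmf (F i)) ->
  \int[P]_x (\sum_(i <- s | Pr i) F i x) = \sum_(i <- s | Pr i) \int[P]_x F i x.
Proof.
move=> bF; elim: s => [|i s IH].
  rewrite big_nil; under eq_Rintegral do rewrite big_nil; exact: mean_cst.
rewrite big_cons; have [Pi|Pi] := boolP (Pr i).
  under eq_Rintegral do rewrite big_cons Pi.
  rewrite meanD ?IH//; first exact: bF.
  exact: bmf_sum.
by under eq_Rintegral do rewrite big_cons (negPf Pi).
Qed.

Lemma mean_le F G : bmf F -> bmf G -> (forall x, F x <= G x) ->
  \int[P]_x F x <= \int[P]_x G x.
Proof.
by move=> bF bG FG; apply: le_Rintegral => //; exact: bmf_integrable.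
Qed.

Lemma mean_ge0 F : (forall x, 0 <= F x) -> 0 <= \int[P]_x F x.
Proof. by move=> F0; apply: Rintegral_ge0. Qed.

Lemma mean_norm F : bmf F -> `|\int[P]_x F x| <= \int[P]_x `|F x|.
Proof. by move=> bF; apply: le_normr_Rintegral => //; exact: bmf_integrable. Qed.

(** Expanding the variance of [|F|], which is nonnegative, gives this case of Cauchy-Schwarz. *)
Lemma mean_norm_le_sqrt F : bmf F ->
  \int[P]_x `|F x| <= Num.sqrt (\int[P]_x F x ^+ 2).
Proof.
move=> bF; set m := \int[P]_x `|F x|.
have m0 : 0 <= m by exact: mean_ge0.
rewrite -(ler_sqr m0) ?nnegrE ?sqrtr_ge0// sqr_sqrtr; last first.
  by apply: mean_ge0 => x; exact: sqr_ge0.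
have := @mean_ge0 (fun x => (`|F x| - m) ^+ 2) (fun x => sqr_ge0 _).
have bN := bmf_norm bF; have bF2 := bmfX 2 bF.
have -> : (fun x => (`|F x| - m) ^+ 2) =
    (fun x => F x ^+ 2 + ((- (2 * m)) * `|F x| + m ^+ 2)).
  by apply/funext => x; rewrite -[F x ^+ 2]real_normK ?num_real//; ring.
have bm := bmfZ (- (2 * m)) bN; have bc := bmf_cst (m ^+ 2).
rewrite meanD//; last exact: bmfD.
rewrite meanD// meanZ// mean_cst -/m; lra.
Qed.

Lemma mean_indic (A : set T) :
  measurable A -> \int[P]_x \1_A x = fine (P A).
Proof. by move=> mA; rewrite /Rintegral integral_indic// setIT. Qed.

Lemma bmf_indic (A : set T) :
  measurable A -> bmf (\1_A : T -> R).
Proof.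
move=> mA; split; first exact: measurable_indic.
by exists 1 => x; rewrite indicE ger0_norm// lern1 leq_b1.
Qed.

End bounded_measurable.

(** [Z] itself may fail to be measurable, so the two sets are compared outside a measurable null set
    [N] that contains it. *)
Lemma measure_eq_off_null d (T : measurableType d) (R : realType)
    (P : {measure set T -> \bar R}) (Z A B : set T) :
  P.-negligible Z -> measurable A -> measurable B ->
  (forall w, ~ Z w -> (A w <-> B w)) -> P A = P B.
Proof.
move=> [N [mN N0 ZN]] mA mB AB.
have cut C : measurable C -> P C = P (C `\` N).
  move=> mC; have CN : P (C `&` N) = 0%E.
    by apply/eqP; rewrite -measure_le0 -N0 le_measure ?inE//; exact: measurableI.
  by transitivity (P (C `\` N) + P (C `&` N))%E; [exact: measureDI|rewrite CN adde0].
rewrite (cut A mA) (cut B mB); congr (P _); apply/seteqP; split => w [Cw Nw].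
  by split => //; apply/AB => // /ZN.
by split => //; apply/AB => // /ZN.
Qed.

Lemma measurable_le_set d (T : measurableType d) (R : realType) (F : T -> R) (y : R) :
  measurable_fun setT F -> measurable [set w | F w <= y].
Proof.
move=> mF; have := mF measurableT [set` `]-oo, y]] (measurable_itv _); rewrite setTI.
by congr (measurable _); apply/seteqP; split => w /=; rewrite in_itv.
Qed.

Section transport.
Context d1 d2 d3 (A : measurableType d1) (B : measurableType d2)
  (C : measurableType d3) (R : realType).

(** [Q] only has to agree with the image of [P] on measurable sets: in [resample] it is the array
    law, given beforehand, and [P] is its product with the law of one fresh row. *)
Lemma mean_transport (P : probability A R) (Q : probability B R) (phi : A -> B) :
  measurable_fun setT phi ->
  (forall E, measurable E -> Q E = P (phi @^-1` E)) ->
  forall F : B -> R, bmf F -> \int[Q]_x F x = \int[P]_x F (phi x).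
Proof.
move=> mphi PQ F bF; have bFphi : bmf (F \o phi).
  case: bF => mF [M hM]; split; last by exists M => x; exact: hM.
  exact: (measurableT_comp mF mphi).
congr fine.
transitivity (\int[pushforward P phi]_x (F x)%:E)%E.
  by apply: (eq_measure_integral (pushforward P phi)) => E mE _; exact: PQ.
rewrite integral_pushforward//.
- by apply/measurable_EFinP; case: bF.
- exact: (bmf_integrable P bFphi).
Qed.

Lemma mean_fubini (P : probability A R) (Q : probability C R) (F : A * C -> R) :
  bmf F ->
  bmf (fun x => \int[Q]_y F (x, y)) /\
  \int[(P \x Q)%E]_z F z = \int[P]_x \int[Q]_y F (x, y).
Proof.
move=> bF.
have iF := bmf_integrable (P \x Q)%E bF.
have bF1 x : bmf (fun y => F (x, y)).
  case: bF => mF [M hM]; split; last by exists M => y; exact: hM.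
  apply: (measurableT_comp mF); exact: measurable_pair1.
have E1 x : (\int[Q]_y F (x, y))%:E = (\int[Q]_y (F (x, y))%:E)%E.
  by rewrite /Rintegral fineK// integrable_fin_num//; exact: bmf_integrable (bF1 x).
split.
  split; last first.
    case: bF => mF [M hM]; exists M => x.
    apply: (le_trans (mean_norm _ (bF1 x))).
    rewrite -[leRHS](mean_cst Q); apply: mean_le => //.
      exact/bmf_norm.
    exact: bmf_cst.
  apply/measurable_EFinP; rewrite (_ : _ \o _ = fubini_F Q (EFin \o F)); last first.
    by apply/funext => x; exact: E1.
  exact: (measurable_fubini_F iF).
congr fine; rewrite -(integral12_prod_meas1 iF).
by apply: eq_integral => x _; rewrite E1.
Qed.

End transport.

(** * Arrays of independent vectors, and resampling of one row *)

Section arrays.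
Context (R : realType) (p n : nat).
Local Notation vec := 'cV[R]_p.

(** These are the generators used in [vborel], so the measurable sets of [vecT] are by conversion
    those of [vborel]. *)
Definition vgen : set (set vec) :=
  [set E | exists (i : 'I_p) (A : set R),
     measurable A /\ E = [set v : vec | A (v i ord0)]].

(* Arrays are indexed by all of [nat], but only the rows 1, ..., n are measurable. *)
Definition cyl (B : nat -> set vec) : set (nat -> vec) :=
  [set x | forall t, (1 <= t <= n)%N -> B t (x t)].

Definition cyls : set (set (nat -> vec)) :=
  [set C | exists B, (forall t, vborel (B t)) /\ C = cyl B].

Definition vecT := g_sigma_algebraType vgen.
HB.instance Definition _ := Measurable.on vecT.
Definition arrT := g_sigma_algebraType cyls.
HB.instance Definition _ := Measurable.on arrT.

Definition upd (x : nat -> vec) (v : nat) (z : vec) : nat -> vec :=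
  fun t => if t == v then z else x t.

Lemma vborelT : vborel (setT : set vec).
Proof. exact: (@measurableT _ vecT). Qed.

Lemma measurable_coord (i : 'I_p) : measurable_fun setT (fun v : vecT => v i ord0).
Proof.
move=> _ A mA; rewrite setTI; apply: sub_sigma_algebra.
by exists i, A.
Qed.

Lemma measurable_entry t : (1 <= t <= n)%N ->
  measurable_fun setT (fun x : arrT => x t : vecT).
Proof.
move=> tn _ B mB; rewrite setTI; apply: sub_sigma_algebra.
exists (fun s => if s == t then B else setT); split.
  by move=> s; case: ifP => // _; exact: vborelT.
apply/seteqP; split => x /=.
  by move=> Bx s _; case: eqP => // ->.
by move/(_ t tn); rewrite eqxx.
Qed.

Lemma measurable_upd v : (1 <= v <= n)%N ->
  measurable_fun setT (fun xz : arrT * vecT => upd xz.1 v xz.2 : arrT).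
Proof.
move=> vn; apply: (@measurability _ _ (arrT * vecT)%type arrT setT _ cyls) => //.
move=> _ [_ [B [mB ->]] <-]; rewrite setTI.
rewrite (_ : _ @^-1` _ =
    cyl (fun t => if t == v then setT else B t) `*` (B v : set vecT)).
  apply: measurableX; last exact: mB.
  apply: sub_sigma_algebra; exists (fun t => if t == v then setT else B t).
  by split => // t; case: ifP => // _; exact: vborelT.
apply/seteqP; split => -[x z] /=.
  move=> H; split => [t tn|].
    by have := H t tn; rewrite /upd; case: ifP.
  by have := H v vn; rewrite /upd eqxx.
by move=> [H1 H2] t tn; rewrite /upd; have := H1 t tn; case: eqP => // ->.
Qed.

Lemma setI_cyls : setI_closed cyls.
Proof.
move=> _ _ [B [mB ->]] [C [mC ->]]; exists (fun t => B t `&` C t); split.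
  by move=> t; exact: (@measurableI _ vecT _ _ (mB t) (mC t)).
apply/seteqP; split => x /=.
  by move=> [hB hC] t tn; split; [exact: hB|exact: hC].
by move=> h; split => t tn; have [] := h t tn.
Qed.

Lemma cylsT : cyls setT.
Proof.
exists (fun=> setT); split; first by move=> t; exact: vborelT.
by apply/seteqP; split.
Qed.

Variables (Q : probability arrT R) (mu : probability vecT R).
Hypothesis Q_prod : forall B : nat -> set vec, (forall t, vborel (B t)) ->
  Q (cyl B) = (\prod_(1 <= t < n.+1) mu (B t))%E.

(** Cylinders are stable under intersection and generate the sigma-algebra, so the two laws are
    compared on them. The preimage of a cylinder is a rectangle: the constraint on row [v] moves to
    the fresh vector and leaves [setT], of mass one, in its place. *)
Lemma cyl_upd_law v : (1 <= v <= n)%N ->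
  forall E : set arrT, measurable E ->
  Q E = (Q \x mu)%E ((fun xz : arrT * vecT => upd xz.1 v xz.2 : arrT) @^-1` E).
Proof.
move=> vn; have mu_ := measurable_upd vn.
pose phi := (fun xz : arrT * vecT => upd xz.1 v xz.2 : arrT).
pose phi_mixin := isMeasurableFun.Build _ _ _ _ phi mu_.
pose phi_pack : {mfun (arrT * vecT)%type >-> arrT} :=
  MeasurableFun.Pack (MeasurableFun.Class phi_mixin).
apply: (@measure_unique _ R arrT cyls (fun=> setT) _ setI_cyls _ _ Q
  (distribution (Q \x mu)%E phi_pack)) => //.
- by move=> _; exact: cylsT.
- by rewrite bigcup_const.
- move=> _ [B [mB ->]]; rewrite /distribution /pushforward /=.
  rewrite (_ : _ @^-1` _ =
    cyl (fun t => if t == v then setT else B t) `*` (B v : set vecT)); last first.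
    apply/seteqP; split => -[x z] /=.
      move=> H; split => [t tn|].
        by have := H t tn; rewrite /phi /upd /=; case: ifP.
      by have := H v vn; rewrite /phi /upd /= eqxx.
    by move=> [H1 H2] t tn; rewrite /phi /upd /=; have := H1 t tn; case: eqP => // ->.
  have mB' (t : nat) : vborel (if t == v then setT else B t).
    by case: ifP => // _; exact: vborelT.
  rewrite product_measure1E//; last 2 first.
  - apply: sub_sigma_algebra.
    by exists (fun t => if t == v then setT else B t); split.
  - exact: mB.
  rewrite Q_prod//= Q_prod// (bigD1_seq v) ?iota_uniq ?mem_index_iota//=.
  rewrite [X in _ = (X * _)%E](bigD1_seq v) ?iota_uniq ?mem_index_iota//= eqxx.
  rewrite [mu setT]probability_setT mul1e muleC; congr (_ * _)%E.
  by apply: eq_bigr => t /negPf ->.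
- by move=> k; rewrite -ge0_fin_numE// fin_num_measure.
Qed.

(** The inner integral is a version of the conditional expectation of [F] given the rows other than
    [v]. *)
Lemma resample v (F : arrT -> R) : (1 <= v <= n)%N -> bmf F ->
  bmf (fun x : arrT => \int[mu]_z F (upd x v z)) /\
  \int[Q]_x F x = \int[Q]_x \int[mu]_z F (upd x v z).
Proof.
move=> vn bF; have mphi := measurable_upd vn.
have [] := @mean_fubini _ _ arrT vecT R Q mu (fun xz => F (upd xz.1 v xz.2)).
  case: bF => mF [M hM]; split; last by exists M => x; exact: hM.
  exact: (measurableT_comp mF mphi).
move=> bI eI; split => //; rewrite -eI.
by apply: (mean_transport mphi) => //; exact: cyl_upd_law.
Qed.

End arrays.

Lemma measurable_funV (R : realType) : measurable_fun setT (fun x : R => x^-1).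
Proof.
rewrite -(setvU [set 0 : R]); apply/measurable_funU => //.
  exact: measurableC.
split; last exact: measurable_fun_set1.
apply: open_continuous_measurable_fun; first by rewrite openC; exact: closed_eq.
by move=> x; rewrite inE /= => /eqP x0; exact: inv_continuous.
Qed.

(** * Moments of the uniform distribution on the sphere *)

Section sphere.
Context (R : realType) (p : nat).
Local Notation vec := 'cV[R]_p.
Implicit Types (x y z : vec).

Definition dot x y : R := \sum_i x i ord0 * y i ord0.

Lemma dotE x y : (x^T *m y) ord0 ord0 = dot x y.
Proof. by rewrite mxE; apply: eq_bigr => i _; rewrite mxE. Qed.

Lemma dotC x y : dot x y = dot y x.
Proof. by apply: eq_bigr => i _; rewrite mulrC. Qed.

Lemma dotDr x y z : dot x (y + z) = dot x y + dot x z.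
Proof. by rewrite -big_split; apply: eq_bigr => i _; rewrite mxE mulrDr. Qed.

Lemma dotZr c x y : dot x (c *: y) = c * dot x y.
Proof. by rewrite mulr_sumr; apply: eq_bigr => i _; rewrite mxE mulrCA. Qed.

Lemma dotNr x y : dot x (- y) = - dot x y.
Proof. by rewrite -scaleN1r dotZr mulN1r. Qed.

Lemma dotBr x y z : dot x (y - z) = dot x y - dot x z.
Proof. by rewrite dotDr dotNr. Qed.

Lemma dotNl x y : dot (- x) y = - dot x y.
Proof. by rewrite dotC dotNr dotC. Qed.

Lemma dotDl x y z : dot (x + y) z = dot x z + dot y z.
Proof. by rewrite dotC dotDr !(dotC z). Qed.

Lemma dotBl x y z : dot (x - y) z = dot x z - dot y z.
Proof. by rewrite dotDl dotNl. Qed.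

Lemma dotZl c x y : dot (c *: x) y = c * dot x y.
Proof. by rewrite dotC dotZr dotC. Qed.

Lemma dot_sumr (I : Type) (s : seq I) (Pr : pred I) (y : I -> vec) x :
  dot x (\sum_(i <- s | Pr i) y i) = \sum_(i <- s | Pr i) dot x (y i).
Proof.
elim/big_rec2 : _ => [|i a b _ <-]; last by rewrite dotDr.
by rewrite /dot big1// => i _; rewrite mxE mulr0.
Qed.

Lemma dot_suml (I : Type) (s : seq I) (Pr : pred I) (y : I -> vec) x :
  dot (\sum_(i <- s | Pr i) y i) x = \sum_(i <- s | Pr i) dot (y i) x.
Proof. by rewrite dotC dot_sumr; apply: eq_bigr => i _; rewrite dotC. Qed.

Lemma dot_ge0 x : 0 <= dot x x.
Proof. by apply: sumr_ge0 => i _; rewrite -expr2 sqr_ge0. Qed.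

Lemma dot_eq0 x : dot x x = 0 -> x = 0.
Proof.
move=> /eqP; rewrite psumr_eq0; last by move=> i _; rewrite -expr2 sqr_ge0.
move=> /allP x0; apply/matrixP => i j; rewrite ord1 mxE.
by have := x0 i (mem_index_enum i); rewrite /= mulf_eq0 orbb => /eqP.
Qed.

Lemma dot_delta x (i : 'I_p) : dot x (delta_mx i ord0) = x i ord0.
Proof.
rewrite /dot (bigD1 i)//= mxE !eqxx mulr1 big1 ?addr0// => j ji.
by rewrite mxE (negPf ji) mulr0.
Qed.

Lemma dot_mulmxl (O : 'M[R]_p) x y : dot (O *m x) y = dot x (O^T *m y).
Proof. by rewrite -!dotE trmx_mul mulmxA. Qed.

Lemma dot_unit_le1 x y : dot x x = 1 -> dot y y = 1 -> `|dot x y| <= 1.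
Proof.
move=> x1 y1; rewrite ler_norml; apply/andP; split.
  have := dot_ge0 (x + y); rewrite dotDr !dotDl x1 y1 (dotC y x); lra.
have := dot_ge0 (x - y); rewrite dotBr !dotBl x1 y1 (dotC y x); lra.
Qed.

(* Householder reflection along y - y'. *)
Lemma orthogonal_sends y y' : dot y y = dot y' y' ->
  exists O : 'M[R]_p, orthogonal_mx O /\ O^T *m y = y'.
Proof.
move=> yy'; have [->|yNy'] := eqVneq y y'.
  by exists 1%:M; rewrite /orthogonal_mx trmx1 mulmx1 mul1mx.
pose w := y - y'; pose c := 2 / dot w w.
have w0 : dot w w != 0.
  by apply: contra_neq yNy' => /dot_eq0 /eqP; rewrite subr_eq0 => /eqP.
have wwE : w^T *m w = (dot w w)%:M.
  by apply/matrixP => i j; rewrite !ord1 dotE mxE eqxx.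
have cw : c * dot w w = 2 by rewrite /c mulfVK.
pose O : 'M[R]_p := 1%:M - c *: (w *m w^T).
have OT : O^T = O.
  by rewrite /O linearB/= linearZ/= trmx1 trmx_mul trmxK.
exists O; split.
  rewrite /orthogonal_mx OT /O mulmxBl mul1mx mulmxBr mulmx1.
  rewrite -scalemxAl -scalemxAr mulmxA -(mulmxA w) wwE -mulmxA mul_scalar_mx.
  rewrite -scalemxAr !scalerA cw; apply/matrixP => i j; rewrite !mxE; ring.
rewrite OT /O mulmxBl mul1mx -scalemxAl -mulmxA.
have -> : w^T *m y = (dot w y)%:M.
  by apply/matrixP => i j; rewrite !ord1 dotE mxE eqxx.
have wy : dot w y = dot w w / 2.
  by rewrite /w !(dotBl, dotBr) -yy' (dotC y' y); field.
rewrite mul_mx_scalar scalerA wy mulrA cw divff ?pnatr_eq0// scale1r /w.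
by apply/matrixP => i j; rewrite !mxE; ring.
Qed.

End sphere.

Section unit_vectors.
Context (R : realType) (p : nat).
Local Notation vec := 'cV[R]_p.
Local Notation vecT := (vecT R p).

Definition uref : vec := const_mx (Num.sqrt p%:R)^-1.

(* udir, except that the origin is sent to the unit vector [uref]: recall [0^-1 = 0]. *)
Definition usph (v : vec) : vec := udir v + (1 - vnorm v / vnorm v) *: uref.

Lemma vnormE (v : vec) : vnorm v = Num.sqrt (dot v v).
Proof. by congr Num.sqrt; apply: eq_bigr => i _; rewrite expr2. Qed.

Lemma vnorm_eq0 (v : vec) : vnorm v = 0 -> v = 0.
Proof.
rewrite vnormE => /eqP; rewrite sqrtr_eq0 => v0.
by apply: dot_eq0; apply/eqP; rewrite eq_le v0 dot_ge0.
Qed.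

Lemma usphE (v : vec) : v != 0 -> usph v = udir v.
Proof.
move=> v0; rewrite /usph divff ?subrr ?scale0r ?addr0//.
by apply: contra_neq v0; exact: vnorm_eq0.
Qed.

Lemma usph0 : usph 0 = uref.
Proof.
rewrite /usph /udir scaler0 add0r vnormE /dot big1 ?sqrtr0 ?mul0r ?subr0 ?scale1r//.
by move=> i _; rewrite mxE mulr0.
Qed.

Hypothesis p_gt0 : (0 < p)%N.

Lemma dot_uref : dot uref uref = 1.
Proof.
have p0 : (0 : R) < p%:R by rewrite ltr0n.
rewrite /dot; under eq_bigr do rewrite !mxE -expr2 exprVn sqr_sqrtr ?ler0n//.
by rewrite sumr_const card_ord -[RHS](@mulVf _ p%:R) ?gt_eqF// mulr_natr.
Qed.

Lemma dot_usph v : dot (usph v) (usph v) = 1.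
Proof.
have [->|v0] := eqVneq v 0; first by rewrite usph0 dot_uref.
have n0 : vnorm v != 0 by apply: contra_neq v0; exact: vnorm_eq0.
rewrite usphE// /udir dotZl dotZr.
have -> : dot v v = vnorm v ^+ 2 by rewrite vnormE sqr_sqrtr// dot_ge0.
by rewrite expr2 mulKf ?mulVf.
Qed.

Lemma usph_le1 v (i : 'I_p) : `|usph v i ord0| <= 1.
Proof.
rewrite -dot_delta; apply: dot_unit_le1; first exact: dot_usph.
by rewrite dot_delta mxE !eqxx.
Qed.

Lemma measurable_udir (i : 'I_p) : measurable_fun setT (fun v : vecT => udir v i ord0).
Proof.
under eq_fun do rewrite mxE.
apply: measurable_funM; last exact: measurable_coord.
apply: (measurableT_comp (@measurable_funV R)).
apply: (measurableT_comp (continuous_measurable_fun (@sqrt_continuous R))).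
by apply: measurable_sum => j; apply: measurable_funX; exact: measurable_coord.
Qed.

Lemma measurable_vnorm : measurable_fun setT (fun v : vecT => vnorm v).
Proof.
apply: (measurableT_comp (continuous_measurable_fun (@sqrt_continuous R))).
by apply: measurable_sum => j; apply: measurable_funX; exact: measurable_coord.
Qed.

Lemma bmf_usph (i : 'I_p) : bmf (fun v : vecT => usph v i ord0).
Proof.
split; last by exists 1 => v; exact: usph_le1.
under eq_fun do rewrite mxE [X in _ + X]mxE.
apply: measurable_funD; first exact: measurable_udir.
apply: measurable_funM => //; apply: measurable_funB => //.
apply: measurable_funM; first exact: measurable_vnorm.
exact: (measurableT_comp (@measurable_funV R) measurable_vnorm).
Qed.

Lemma bmf_dot_usph (y : vec) : bmf (fun v : vecT => dot (usph v) y).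
Proof. by apply: bmf_sum => i _; apply: bmfM; [exact: bmf_usph|exact: bmf_cst]. Qed.

Lemma measurable_vecT d (T : measurableType d) (phi : T -> vecT) :
  (forall i : 'I_p, measurable_fun setT (fun x => phi x i ord0)) ->
  measurable_fun setT phi.
Proof.
move=> mphi; apply: (@measurability _ _ T vecT setT _ (@vgen R p)) => //.
move=> _ [_ [i [A [mA ->]]] <-]; exact: mphi.
Qed.

Lemma measurable_usph : measurable_fun setT (fun v : vecT => usph v : vecT).
Proof. by apply: measurable_vecT => i; have [] := bmf_usph i. Qed.

Lemma vborel0 : vborel [set 0 : vec].
Proof.
have m0 : measurable_fun setT (fun v : vecT => vnorm v) by exact: measurable_vnorm.
have := m0 measurableT [set 0] (measurable_set1 0); rewrite setTI.
congr (_ _); apply/seteqP; split => v /=; first exact: vnorm_eq0.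
move=> ->; rewrite vnormE /dot big1 ?sqrtr0// => i _; by rewrite mxE mulr0.
Qed.

Variable mu : probability vecT R.
Hypothesis mu0 : mu [set 0] = 0%E.
Hypothesis mu_rot : forall (O : 'M[R]_p) (B : set vec), orthogonal_mx O ->
  vborel B -> mu ((fun v => udir v) @^-1` B) = mu ((fun v => O *m udir v) @^-1` B).

(** Invariance is assumed for [udir]; it passes to [usph] because the two maps differ only at the
    origin, a null set. *)
Lemma usph_rot_law (O : 'M[R]_p) (B : set vec) : orthogonal_mx O -> vborel B ->
  mu ((fun v => usph v) @^-1` B) = mu ((fun v => O *m usph v) @^-1` B).
Proof.
move=> oO mB.
have mudir : measurable_fun setT (fun v : vecT => udir v : vecT).
  by apply: measurable_vecT => i; exact: measurable_udir.
have mO : measurable_fun setT (fun v : vecT => O *m v : vecT).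
  apply: measurable_vecT => i; under eq_fun do rewrite mxE.
  by apply: measurable_sum => j; apply: measurable_funM => //; exact: measurable_coord.
have key (phi psi : vecT -> vecT) : measurable_fun setT phi -> measurable_fun setT psi ->
    (forall v, v != 0 -> phi v = psi v) -> mu (phi @^-1` B) = mu (psi @^-1` B).
  move=> mphi mpsi e.
  have m1 : measurable (phi @^-1` B : set vecT) by rewrite -[X in measurable X]setTI; exact: mphi.
  have m2 : measurable (psi @^-1` B : set vecT) by rewrite -[X in measurable X]setTI; exact: mpsi.
  apply: (@measure_eq_off_null _ _ _ mu [set 0]) => //.
    by apply/negligibleP => //; exact: vborel0.
  by move=> v /eqP v0 /=; rewrite e.
rewrite (key _ _ measurable_usph mudir); last by move=> v /usphE.
rewrite (mu_rot oO mB); apply: key => [||v /usphE -> //].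
  exact: (measurableT_comp mO mudir).
exact: (measurableT_comp mO measurable_usph).
Qed.

Lemma usph_id v : dot v v = 1 -> usph v = v.
Proof.
move=> v1; rewrite usphE /udir ?vnormE ?v1 ?sqrtr1 ?invr1 ?scale1r//.
apply: contra_eq_neq v1 => ->; rewrite /dot big1 ?(eq_sym 0) ?oner_neq0//.
by move=> i _; rewrite mxE mulr0.
Qed.

(** Only [g (usph v)] is known to be measurable, not [g]. Since [usph] fixes the unit sphere, [g]
    may be replaced by its composition with [usph], which can be integrated against the law of
    [usph]. *)
Lemma mean_rot (O : 'M[R]_p) (g : vec -> R) : orthogonal_mx O ->
  bmf (fun v : vecT => g (usph v)) ->
  \int[mu]_v g (usph v) = \int[mu]_v g (O *m usph v).
Proof.
move=> oO bg.
have mO : measurable_fun setT (fun v : vecT => O *m usph v : vecT).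
  apply: measurable_vecT => i; under eq_fun do rewrite mxE.
  apply: measurable_sum => j; apply: measurable_funM => //.
  by have [] := bmf_usph j.
pose mix := isMeasurableFun.Build _ _ vecT vecT (fun v : vecT => usph v : vecT) measurable_usph.
pose pack : {mfun vecT >-> vecT} := MeasurableFun.Pack (MeasurableFun.Class mix).
transitivity (\int[distribution mu pack]_v g (usph v)).
  transitivity (\int[mu]_v g (usph (usph v))).
    by apply: eq_Rintegral => v _; rewrite (usph_id (dot_usph v)).
  by apply/esym; exact: (mean_transport measurable_usph).
transitivity (\int[mu]_v g (usph (O *m usph v))).
  by apply: (mean_transport mO) => // E mE; exact: usph_rot_law.
apply: eq_Rintegral => v _; rewrite (usph_id (v := O *m usph v))//.
by rewrite dot_mulmxl mulmxA oO mul1mx dot_usph.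
Qed.

End unit_vectors.

Section moments.
Context (R : realType) (p : nat).
Hypothesis p_gt0 : (0 < p)%N.
Local Notation vec := 'cV[R]_p.
Local Notation vecT := (vecT R p).
Variable mu : probability vecT R.
Hypothesis mu0 : mu [set 0] = 0%E.
Hypothesis mu_rot : forall (O : 'M[R]_p) (B : set vec), orthogonal_mx O ->
  vborel B -> mu ((fun v => udir v) @^-1` B) = mu ((fun v => O *m udir v) @^-1` B).

Definition moment k (y : vec) : R := \int[mu]_v dot (usph v) y ^+ k.

(** [uref] is merely a convenient unit vector: by [moment_eqnorm] all unit vectors give this
    value. *)
Definition dirm k : R := moment k (uref R p).

Let bd (y : vec) := bmf_dot_usph p_gt0 y.
Let bc (i : 'I_p) := bmf_usph R p_gt0 i.

Lemma moment_eqnorm k y y' : dot y y = dot y' y' -> moment k y = moment k y'.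
Proof.
move=> /orthogonal_sends [M [oM My]]; rewrite /moment.
rewrite (mean_rot p_gt0 mu0 mu_rot (g := fun u => dot u y ^+ k) oM); last exact/bmfX/bd.
by apply: eq_Rintegral => v _; rewrite dot_mulmxl My.
Qed.

Lemma mean_usph_opp (g : vec -> R) : bmf (fun v : vecT => g (usph v)) ->
  \int[mu]_v g (usph v) = \int[mu]_v g (- usph v).
Proof.
move=> bg; have oN : orthogonal_mx ((-1)%:M : 'M[R]_p).
  by rewrite /orthogonal_mx tr_scalar_mx -scalar_mxM mulrNN mulr1.
apply: (etrans (mean_rot p_gt0 mu0 mu_rot oN bg)).
by apply: eq_Rintegral => v _; rewrite mul_scalar_mx scaleN1r.
Qed.

Lemma moment1 y : moment 1 y = 0.
Proof.
have e := mean_usph_opp (g := fun u => dot u y ^+ 1) (bmfX 1 (bd y)).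
have : moment 1 y = - moment 1 y.
  rewrite {1}/moment e -mulN1r -meanZ; last exact: bmfX (bd y).
  by apply: eq_Rintegral => v _; rewrite dotNl !expr1 mulN1r.
lra.
Qed.

(** By rotation invariance [y] may be replaced by the multiple of [uref] that has the same norm. *)
Lemma moment_even j y : moment (2 * j) y = dot y y ^+ j * dirm (2 * j).
Proof.
set s := Num.sqrt (dot y y).
rewrite (@moment_eqnorm _ _ (s *: uref R p)); last first.
  by rewrite dotZl dotZr dot_uref// mulr1 -expr2 sqr_sqrtr// dot_ge0.
rewrite -[dot y y in RHS]sqr_sqrtr ?dot_ge0// -exprM /dirm /moment -/s -meanZ; last exact/bmfX/bd.
by apply: eq_Rintegral => v _; rewrite dotZr exprMn.
Qed.

Lemma mean_coord k (i : 'I_p) : \int[mu]_v usph v i ord0 ^+ k = dirm k.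
Proof.
rewrite /dirm -(@moment_eqnorm _ (delta_mx i ord0)); last first.
  by rewrite dot_uref// dot_delta mxE !eqxx.
by apply: eq_Rintegral => v _; rewrite dot_delta.
Qed.

Let pR : R := p%:R.
Let p0 : 0 < pR. Proof. by rewrite ltr0n. Qed.

Lemma sum_usph_sqr v : \sum_(i < p) usph v i ord0 ^+ 2 = 1 :> R.
Proof. by rewrite -[RHS](dot_usph p_gt0 v); apply: eq_bigr => i _; rewrite expr2. Qed.

Lemma dirm2 : dirm 2 = p%:R^-1.
Proof.
have : \sum_(i < p) \int[mu]_v usph v i ord0 ^+ 2 = 1.
  rewrite -mean_sum; last by move=> i _; exact/bmfX/bc.
  by rewrite -[RHS](mean_cst mu); apply: eq_Rintegral => v _; exact: sum_usph_sqr.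
under eq_bigr do rewrite mean_coord.
rewrite sumr_const card_ord => h.
by apply: (mulIf (lt0r_neq0 p0)); rewrite mulVf ?lt0r_neq0// /pR mulr_natr.
Qed.

Let e1 (i : 'I_p) : vec := delta_mx i ord0.

Let dot_e (i j : 'I_p) : dot (e1 i) (e1 j) = (i == j)%:R.
Proof. by rewrite dot_delta mxE eqxx andbT eq_sym. Qed.

(* Both e_i + e_j and e_i - e_j have norm sqrt 2, so comparing their moments with
   those of e_i gives the mixed moments of two coordinates without any integration. *)
Lemma mean_pm k (i j : 'I_p) : i != j ->
  \int[mu]_v ((usph v i ord0 + usph v j ord0) ^+ (2 * k) +
              (usph v i ord0 - usph v j ord0) ^+ (2 * k)) =
  2 ^+ k.+1 * dirm (2 * k).
Proof.
move=> ij; rewrite meanD; last 2 first.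
- by apply: bmfX; exact: bmfD.
- by apply: bmfX; exact: bmfB.
have hp : dot (e1 i + e1 j) (e1 i + e1 j) = 2.
  rewrite dotDr !dotDl !dot_e !eqxx (negPf ij) eq_sym (negPf ij) /=; ring.
have hm : dot (e1 i - e1 j) (e1 i - e1 j) = 2.
  rewrite dotBr !dotBl !dot_e !eqxx (negPf ij) eq_sym (negPf ij) /=; ring.
transitivity (moment (2 * k) (e1 i + e1 j) + moment (2 * k) (e1 i - e1 j)).
  by congr (_ + _); apply: eq_Rintegral => v _; rewrite !(dotDr, dotNr) !dot_delta.
rewrite !moment_even hp hm exprS; ring.
Qed.

(** By [mean_pm] the mixed moment of two squared coordinates is [dirm 4 / 3]. Multiplying u_i^2 by
    |u|^2 = 1 then gives a linear equation, whose solution is 3 / (p (p + 2)). *)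
Lemma dirm4 : dirm 4 <= 3 / p%:R ^+ 2.
Proof.
have ij4 (i j : 'I_p) : i != j ->
    \int[mu]_v (usph v i ord0 ^+ 2 * usph v j ord0 ^+ 2) = dirm 4 / 3.
  move=> ij; have := @mean_pm 2 i j ij.
  have b4 k := bmfX 4 (bc k).
  have b22 := bmfM (bmfX 2 (bc i)) (bmfX 2 (bc j)).
  rewrite (_ : \int[mu]_v _ = \int[mu]_v (2 * (usph v i ord0 ^+ 4 + usph v j ord0 ^+ 4) +
      12 * (usph v i ord0 ^+ 2 * usph v j ord0 ^+ 2))); last first.
    by apply: eq_Rintegral => v _; ring.
  rewrite meanD ?meanZ ?meanD ?mean_coord//; [|exact: bmfD|apply: bmfZ; exact: bmfD|exact: bmfZ].
  by rewrite (_ : (2 * 2)%N = 4)// => h; lra.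
have i0 : 'I_p by exact: Ordinal p_gt0.
have : \sum_(j < p) \int[mu]_v (usph v i0 ord0 ^+ 2 * usph v j ord0 ^+ 2) = dirm 2.
  rewrite -mean_sum; last by move=> j _; exact: (bmfM (bmfX 2 (bc _)) (bmfX 2 (bc _))).
  rewrite -(mean_coord 2 i0); apply: eq_Rintegral => v _.
  by rewrite -mulr_sumr sum_usph_sqr mulr1.
rewrite (bigD1 i0)//= (eq_bigr (fun=> dirm 4 / 3)); last first.
  by move=> j ji; apply: ij4; rewrite eq_sym.
rewrite sumr_const cardC1 card_ord.
have -> : \int[mu]_v (usph v i0 ord0 ^+ 2 * usph v i0 ord0 ^+ 2) = dirm 4.
  by rewrite -(mean_coord 4 i0); apply: eq_Rintegral => v _; rewrite -exprD.
rewrite -[_ *+ p.-1]mulr_natr dirm2.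
have -> : p.-1%:R = pR - 1 by rewrite /pR -[in RHS](prednK p_gt0) -natr1 addrK.
rewrite -/pR => h.
have -> : dirm 4 = 3 / (pR * (pR + 2)).
  have : dirm 4 * (pR + 2) = 3 / pR by rewrite -h; field.
  move=> h2; rewrite -[LHS](@mulfK _ (pR + 2)) ?h2 ?gt_eqF ?addr_gt0//.
  by field; rewrite !gt_eqF// addr_gt0.
rewrite ler_pM2l// lef_pV2 ?posrE ?mulr_gt0 ?exprn_gt0 ?addr_gt0// expr2.
by rewrite ler_pM2l// lerDl.
Qed.

(** Here [mean_pm] yields only the symmetrised mixed moment [m42 i j + m42 j i], so the relation
    u_i^4 |u|^2 = u_i^4 is summed over [i] as well. The outcome is (p + 4) [dirm 6] = 5 [dirm 4]. *)
Lemma dirm6 : dirm 6 <= 15 / p%:R ^+ 3.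
Proof.
have b24 i j := bmfM (bmfX 4 (bc i)) (bmfX 2 (bc j)).
pose m42 i j := \int[mu]_v (usph v i ord0 ^+ 4 * usph v j ord0 ^+ 2).
have ij6 (i j : 'I_p) : i != j -> m42 i j + m42 j i = 2 / 5 * dirm 6.
  move=> ij; have := @mean_pm 3 i j ij.
  have b6 k := bmfX 6 (bc k).
  rewrite (_ : \int[mu]_v _ = \int[mu]_v (2 * (usph v i ord0 ^+ 6 + usph v j ord0 ^+ 6) +
      30 * (usph v i ord0 ^+ 4 * usph v j ord0 ^+ 2 +
            usph v j ord0 ^+ 4 * usph v i ord0 ^+ 2))); last first.
    by apply: eq_Rintegral => v _; ring.
  have bA := bmfD (b6 i) (b6 j); have bB := bmfD (b24 i j) (b24 j i).
  rewrite (meanD _ (bmfZ 2 bA) (bmfZ 30 bB)) (meanZ _ _ bA) (meanZ _ _ bB).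
  rewrite (meanD _ (b6 i) (b6 j)) (meanD _ (b24 i j) (b24 j i)) !mean_coord.
  by rewrite (_ : (2 * 3)%N = 6)// -/(m42 i j) -/(m42 j i) => h; lra.
have row i : \sum_(j < p) m42 i j = dirm 4.
  rewrite -mean_sum; last by move=> j _; exact: b24.
  rewrite -(mean_coord 4 i); apply: eq_Rintegral => v _.
  by rewrite -mulr_sumr sum_usph_sqr mulr1.
have : \sum_(i < p) \sum_(j < p) (m42 i j + m42 j i) = 2 * (pR * dirm 4).
  under eq_bigr do rewrite big_split/=.
  rewrite big_split/= [X in _ + X]exchange_big/=.
  under eq_bigr do rewrite row.
  by rewrite sumr_const card_ord -mulr_natr -/pR; ring.
have dg i : m42 i i = dirm 6.
  by rewrite -(mean_coord 6 i); apply: eq_Rintegral => v _; rewrite -exprD.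
under eq_bigr => i _.
  rewrite (bigD1 i)//= dg (eq_bigr (fun=> 2 / 5 * dirm 6)); last first.
    by move=> j ji; apply: ij6; rewrite eq_sym.
  rewrite sumr_const cardC1 card_ord -[_ *+ p.-1]mulr_natr.
  over.
rewrite sumr_const card_ord -[X in X = _]mulr_natr.
have -> : p.-1%:R = pR - 1 by rewrite /pR -[in RHS](prednK p_gt0) -natr1 addrK.
rewrite -/pR => h.
have h2 : dirm 6 * (pR + 4) = 5 * dirm 4.
  apply: (mulfI (lt0r_neq0 p0)); move: h; move: (dirm 6) (dirm 4) => a b h; lra.
have p4 : 0 < pR + 4 by rewrite addr_gt0.
have -> : dirm 6 = 5 * dirm 4 / (pR + 4) by rewrite -h2 mulfK ?gt_eqF.
have -> : 15 / pR ^+ 3 = 5 * (3 / pR ^+ 2) / pR by field; rewrite gt_eqF.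
have d40 : 0 <= dirm 4 by apply: mean_ge0 => v; rewrite exprn_even_ge0.
apply: ler_pM; rewrite ?invr_ge0 ?mulr_ge0 ?(ltW p4)//.
  by rewrite ler_pM2l//; exact: dirm4.
by rewrite lef_pV2 ?posrE// lerDl.
Qed.

End moments.

(** * The Gaussian distribution function and the heat equation *)

Section calculus.
Context (R : realType).
Implicit Types (F : R -> R) (y z k B : R).

(** The hypotheses are confined to the segment from [z] to [z + k] because [taylor1_le] is also
    applied in the time variable, where the derivatives are established only at positive times. *)
Lemma mvt_le F (F1 : R -> R) z k B :
  (forall u, 0 <= u <= 1 -> is_derive (z + u * k) 1 F (F1 (z + u * k))) ->
  (forall u, 0 <= u <= 1 -> `|F1 (z + u * k)| <= B) ->
  `|F (z + k) - F z| <= B * `|k|.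
Proof.
move=> dF F1B.
pose f (u : R) := F (z + u * k).
have df (u : R) : 0 <= u <= 1 -> is_derive u 1 f (F1 (z + u * k) * k).
  move=> u01; have dFu := dF u u01.
  have dl : is_derive u 1 (fun u : R => z + u * k) k.
    apply: is_derive_eq.
    rewrite /GRing.scale /=; ring.
  have := @is_derive1_comp R F (fun u : R => z + u * k) u _ _ dFu dl.
  by rewrite /f mulrC.
have cf : {within `[0, 1], continuous f}.
  apply: derivable_within_continuous => u.
  by rewrite in_itv /= => /df /@ex_derive.
have [u|u u01] := @MVT R f (fun u => F1 (z + u * k) * k) 0 1 ltr01 _ cf.
  by rewrite in_itv /= => /andP[u0 u1]; apply: df; rewrite !ltW.
rewrite /f mul1r mul0r addr0 subr0 mulr1 => ->.
rewrite normrM ler_wpM2r//; apply: F1B.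
by move: u01; rewrite in_itv /= => /andP[u0 u1]; rewrite !ltW.
Qed.

Lemma taylor1_le F (F1 F2 : R -> R) z k B : 0 <= B ->
  (forall u, 0 <= u <= 1 -> is_derive (z + u * k) 1 F (F1 (z + u * k))) ->
  (forall u, 0 <= u <= 1 -> is_derive (z + u * k) 1 F1 (F2 (z + u * k))) ->
  (forall u, 0 <= u <= 1 -> `|F2 (z + u * k)| <= B) ->
  `|F (z + k) - F z - k * F1 z| <= B * `|k| ^+ 2.
Proof.
move=> B0 dF dF1 F2B.
pose G (y : R) := F y - y * F1 z.
have dG u : 0 <= u <= 1 -> is_derive (z + u * k) 1 G (F1 (z + u * k) - F1 z).
  move=> u01; have dFu := dF u u01; apply: is_derive_eq.
  by rewrite /GRing.scale /=; ring.
have := @mvt_le G (fun y => F1 y - F1 z) z k (B * `|k|) dG.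
rewrite (_ : G (z + k) - G z = F (z + k) - F z - k * F1 z); last by rewrite /G; ring.
rewrite -mulrA -expr2; apply => u u01; have /andP[u0 u1] := u01.
apply: (@le_trans _ _ (B * `|u * k|)).
  apply: (mvt_le (F1 := F2)) => v /andP[v0 v1]; rewrite mulrA.
    by apply: dF1; rewrite mulr_ge0//= mulr_ile1.
  by apply: F2B; rewrite mulr_ge0//= mulr_ile1.
by rewrite ler_wpM2l// normrM ler_piMl// ger0_norm.
Qed.

Lemma taylor2_le F (F1 F2 F3 : R -> R) z k B : 0 <= B ->
  (forall y, is_derive y 1 F (F1 y)) ->
  (forall y, is_derive y 1 F1 (F2 y)) ->
  (forall y, is_derive y 1 F2 (F3 y)) ->
  (forall y, `|F3 y| <= B) ->
  `|F (z + k) - F z - k * F1 z - k ^+ 2 / 2 * F2 z| <= B * `|k| ^+ 3.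
Proof.
move=> B0 dF dF1 dF2 F3B.
(* The derivative of [G] is the first-order Taylor remainder of [F1], which [taylor1_le] controls
   along the segment; the factor 1/6 is given up. *)
pose G (y : R) := F y - y * F1 z - (y - z) ^+ 2 / 2 * F2 z.
have dG (y : R) : is_derive y 1 G (F1 y - F1 z - (y - z) * F2 z).
  have dFu := dF y; apply: is_derive_eq.
  by rewrite /GRing.scale /=; field.
have := @mvt_le G (fun y => F1 y - F1 z - (y - z) * F2 z) z k (B * `|k| ^+ 2) (fun _ _ => dG _).
rewrite (_ : G (z + k) - G z = F (z + k) - F z - k * F1 z - k ^+ 2 / 2 * F2 z); last first.
  by rewrite /G; field.
rewrite -[B * _ * _]mulrA -exprSr; apply => u /andP[u0 u1].
have := @taylor1_le F1 F2 F3 z (u * k) B B0 (fun _ _ => dF1 _) (fun _ _ => dF2 _)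
  (fun _ _ => F3B _).
rewrite (_ : z + u * k - z = u * k); last by ring.
move/le_trans; apply; rewrite ler_wpM2l// normrM exprMn ler_piMl ?exprn_ge0//.
by rewrite exprn_ile1 ?normr_ge0// ger0_norm.
Qed.

End calculus.

Section gaussian.
Context (R : realType).
Implicit Types (x y z s : R).

Definition gpdf z : R := normal_pdf 0 1 z.
Definition gcdf z : R := \int[@lebesgue_measure R]_(t in [set` `]-oo, z]]) gpdf t.

Lemma gpdfE z : gpdf z = normal_peak 1 * expR (- (z ^+ 2 / 2)).
Proof.
by rewrite /gpdf normal_pdfE ?oner_neq0//= /normal_fun subr0 expr1n mulNr.
Qed.

Lemma gpdf_ge0 z : 0 <= gpdf z.
Proof. exact: normal_pdf_ge0. Qed.

Lemma gpdf_integrable (D : set R) : measurable D ->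
  (@lebesgue_measure R).-integrable D (EFin \o gpdf).
Proof.
move=> mD; apply: (@integrableS _ _ _ _ setT) => //.
exact: integrable_normal_pdf.
Qed.

Lemma gcdfE z : (gcdf z)%:E = normal_prob 0 1 `]-oo, z].
Proof.
by rewrite /gcdf /Rintegral fineK// integrable_fin_num//; exact: gpdf_integrable.
Qed.

Lemma is_derive_gcdf z : is_derive z 1 gcdf (gpdf z).
Proof.
have lt1 : z < z + 1 by rewrite ltrDl.
have ig : (@lebesgue_measure R).-integrable [set` `]-oo, (z + 1)]] (EFin \o gpdf).
  exact: gpdf_integrable.
have cg : {for z, continuous gpdf} by have := @continuous_normal_pdf R 0 1 (oner_neq0 R) z.
have [|d e] := continuous_FTC1 lt1 ig _ cg; first by rewrite ltNyr.
by split; [exact: d | rewrite -derive1E; exact: e].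
Qed.

Lemma is_derive_gpdf z : is_derive z 1 gpdf (- z * gpdf z).
Proof.
rewrite (_ : gpdf = fun z => normal_peak 1 * expR (- (z ^+ 2 / 2))); last first.
  by apply/funext => y; rewrite gpdfE.
by apply: is_derive_eq; rewrite /GRing.scale /=; field.
Qed.

Definition gpdf1 z : R := - z * gpdf z.
Definition gpdf2 z : R := (z ^+ 2 - 1) * gpdf z.

Lemma is_derive_gpdf1 z : is_derive z 1 gpdf1 (gpdf2 z).
Proof.
have := is_derive_gpdf z => dg; apply: is_derive_eq.
by rewrite /gpdf2 /GRing.scale /=; ring.
Qed.

Definition gbound : R := 8 * normal_peak 1.

(** With |z| = 2w the exponential is exp(w^2)^-2, and exp(w^2) >= 1 + w^2, so it suffices that
    (2w)^k <= 8 (1 + w^2)^2. The 8 in [gbound] is 2^k for the largest exponent k = 3. *)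
Lemma gpdf_moment k z : (k <= 3)%N -> `|z| ^+ k * gpdf z <= gbound.
Proof.
move=> k3; rewrite gpdfE mulrCA /gbound [leRHS]mulrC ler_wpM2l ?normal_peak_ge0//.
set w := `|z| / 2.
have w0 : 0 <= w by rewrite divr_ge0.
have zw : `|z| = 2 * w by rewrite /w mulrC divfK.
have e2 : expR (- (z ^+ 2 / 2)) = (expR (w ^+ 2))^-1 ^+ 2.
  by rewrite -[z ^+ 2]real_normK ?num_real// zw expRN exprVn -expRM_natl;
    congr ((expR _)^-1); field.
rewrite e2 exprVn ler_pdivrMr ?exprn_gt0 ?expR_gt0//.
have ge : (1 + w ^+ 2) ^+ 2 <= expR (w ^+ 2) ^+ 2.
  by rewrite lerXn2r ?nnegrE ?expR_ge0 ?addr_ge0 ?sqr_ge0// expR_ge1Dx.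
apply: (le_trans _ (ler_wpM2l _ ge)) => //.
rewrite zw; case: k k3 => [|[|[|[|//]]]] _.
- by nra.
- by nra.
- by nra.
- have : 0 <= w ^+ 2 * (w - 1) ^+ 2 by rewrite mulr_ge0 ?sqr_ge0.
  have := sqr_ge0 w; have := exprn_ge0 3 w0; nra.
Qed.

Definition heat (a s x : R) : R := gcdf ((a - x) / Num.sqrt s).
Definition heat1 (a s x : R) : R := - gpdf ((a - x) / Num.sqrt s) / Num.sqrt s.
Definition heat2 (a s x : R) : R := gpdf1 ((a - x) / Num.sqrt s) / s.

Lemma gbound_ge0 : 0 <= gbound.
Proof. by rewrite mulr_ge0 ?normal_peak_ge0. Qed.

Lemma gpdf_le z : `|gpdf z| <= gbound.
Proof. by have := @gpdf_moment 0 z isT; rewrite mul1r ger0_norm ?gpdf_ge0. Qed.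

Lemma gpdf1_le z : `|gpdf1 z| <= gbound.
Proof.
by have := @gpdf_moment 1 z isT; rewrite expr1 normrM normrN (ger0_norm (gpdf_ge0 z)).
Qed.

Lemma gpdf2_le z : `|gpdf2 z| <= 2 * gbound.
Proof.
have h2 := @gpdf_moment 2 z isT; have h0 := @gpdf_moment 0 z isT.
rewrite normrM (ger0_norm (gpdf_ge0 z)).
apply: (@le_trans _ _ ((`|z| ^+ 2 + 1) * gpdf z)).
  rewrite ler_wpM2r ?gpdf_ge0// (le_trans (ler_normB _ _))// normr1 normrX lexx//.
by move: h0 h2; rewrite expr0; lra.
Qed.

Lemma zgpdf2_le z : `|z * gpdf2 z| <= 2 * gbound.
Proof.
have h3 := @gpdf_moment 3 z isT; have h1 := @gpdf_moment 1 z isT.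
rewrite normrM normrM (ger0_norm (gpdf_ge0 z)).
apply: (@le_trans _ _ (`|z| * ((`|z| ^+ 2 + 1) * gpdf z))).
  rewrite ler_wpM2l// ler_wpM2r ?gpdf_ge0// (le_trans (ler_normB _ _))// normr1 normrX lexx//.
by move: h1 h3; rewrite expr1 exprS; lra.
Qed.

(* [heat2 a s] is the second space derivative, so this is the heat equation. *)
Lemma is_derive_heat_time a x s : 0 < s ->
  is_derive s 1 (fun s => heat a s x) (heat2 a s x / 2).
Proof.
move=> s0; have q0 : 0 < Num.sqrt s by rewrite sqrtr_gt0.
have dz : is_derive s 1 (fun s => (a - x) / Num.sqrt s)
    (- ((a - x) / Num.sqrt s) / (2 * s)).
  have dq := is_derive1_sqrt s0; have qN := lt0r_neq0 q0.
  have dV := is_deriveV qN dq; apply: is_derive_eq.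
  rewrite /GRing.scale /= -[X in _ = _ / (2 * X)](@sqr_sqrtr _ s) ?ltW//; field.
  by rewrite qN.
have dg := is_derive_gcdf ((a - x) / Num.sqrt s).
have dc := @is_derive1_comp R gcdf (fun s => (a - x) / Num.sqrt s) s _ _ dg dz.
apply: (is_derive_eq dc).
by rewrite /heat2 /gpdf1; move: (_ / Num.sqrt s) => z; field; rewrite gt_eqF.
Qed.

(** The second time derivative of [heat], written with [gpdf2] so that the moment bounds on [gpdf]
    apply. *)
Definition heat_tt (a s x : R) : R := let z := (a - x) / Num.sqrt s in
  - (z * gpdf2 z) / (4 * s ^+ 2) - gpdf1 z / (2 * s ^+ 2).

Lemma is_derive_heat2 a x s : 0 < s ->
  is_derive s 1 (fun s => heat2 a s x / 2) (heat_tt a s x).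
Proof.
move=> s0; have q0 : 0 < Num.sqrt s by rewrite sqrtr_gt0.
have sN := lt0r_neq0 s0.
have dz : is_derive s 1 (fun s => (a - x) / Num.sqrt s)
    (- ((a - x) / Num.sqrt s) / (2 * s)).
  have dq := is_derive1_sqrt s0; have qN := lt0r_neq0 q0.
  have dV := is_deriveV qN dq; apply: is_derive_eq.
  rewrite /GRing.scale /= -[X in _ = _ / (2 * X)](@sqr_sqrtr _ s) ?ltW//; field.
  by rewrite qN.
have dg := is_derive_gpdf1 ((a - x) / Num.sqrt s).
have dc := @is_derive1_comp R gpdf1 (fun s => (a - x) / Num.sqrt s) s _ _ dg dz.
have dV := is_deriveV sN (is_derive_id s 1).
rewrite (_ : (fun s => heat2 a s x / 2) =
  fun s => (gpdf1 \o (fun s => (a - x) / Num.sqrt s)) s * s^-1 / 2)//.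
apply: is_derive_eq.
rewrite /GRing.scale /= /heat_tt /=; move: (_ / Num.sqrt s) => z; field.
by rewrite sN.
Qed.

Lemma heat_tt_le a x s s0 : 0 < s0 -> s0 <= s ->
  `|heat_tt a s x| <= gbound / s0 ^+ 2.
Proof.
move=> s00 s0s; have sp : 0 < s by exact: lt_le_trans s0s.
rewrite /heat_tt /=; move: (_ / Num.sqrt s) => z.
have e : - (z * gpdf2 z) / (4 * s ^+ 2) - gpdf1 z / (2 * s ^+ 2) =
   (- (z * gpdf2 z) / 4 - gpdf1 z / 2) / s ^+ 2 by field; rewrite gt_eqF.
rewrite e normrM ler_pM//.
  apply: (le_trans (ler_normB _ _)).
  rewrite (normrM (- _)) normrN (normrM (gpdf1 z)) !(ger0_norm (_ : 0 <= _^-1)) ?invr_ge0//.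
  by have := zgpdf2_le z; have := gpdf1_le z; lra.
rewrite ger0_norm; last by rewrite invr_ge0 exprn_ge0// ltW.
rewrite lef_pV2 ?posrE ?exprn_gt0//.
by apply: lerXn2r; rewrite ?nnegrE ?(ltW s00) ?(ltW sp).
Qed.

Lemma heat_time_step a x s s0 k : 0 < s0 -> s0 <= s -> 0 <= k ->
  `|heat a (s + k) x - heat a s x - k * (heat2 a s x / 2)| <= gbound / s0 ^+ 2 * k ^+ 2.
Proof.
move=> s00 s0s k0.
have pos u : 0 <= u <= 1 -> s0 <= s + u * k.
  by move=> /andP[u0 _]; rewrite (le_trans s0s)// lerDl mulr_ge0.
have pos0 u : 0 <= u <= 1 -> 0 < s + u * k by move=> /pos; exact: lt_le_trans.
have := @taylor1_le R (fun s => heat a s x) (fun s => heat2 a s x / 2)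
  (fun s => heat_tt a s x) s k (gbound / s0 ^+ 2).
rewrite (ger0_norm k0); apply.
- by rewrite divr_ge0 ?gbound_ge0// exprn_ge0// ltW.
- by move=> u u01; apply: is_derive_heat_time; exact: pos0.
- by move=> u u01; apply: is_derive_heat2; exact: pos0.
- by move=> u u01; apply: heat_tt_le => //; exact: pos.
Qed.

Lemma heat_space_step a x s s0 k : 0 < s0 -> s0 <= s ->
  `|heat a s (x + k) - heat a s x - k * heat1 a s x - k ^+ 2 / 2 * heat2 a s x|
  <= 2 * gbound / Num.sqrt s0 ^+ 3 * `|k| ^+ 3.
Proof.
move=> s00 s0s; have sp : 0 < s by exact: lt_le_trans s0s.
have q0 : 0 < Num.sqrt s by rewrite sqrtr_gt0.
have q00 : 0 < Num.sqrt s0 by rewrite sqrtr_gt0.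
have B0 : 0 <= 2 * gbound by rewrite mulr_ge0 ?gbound_ge0.
have := @taylor2_le R gcdf gpdf gpdf1 gpdf2 ((a - x) / Num.sqrt s) (- k / Num.sqrt s)
  (2 * gbound) B0 is_derive_gcdf is_derive_gpdf is_derive_gpdf1 gpdf2_le.
rewrite /heat (_ : (a - x) / Num.sqrt s + - k / Num.sqrt s = (a - (x + k)) / Num.sqrt s);
  last by rewrite -mulrDl; congr (_ / _); ring.
rewrite (_ : - k / Num.sqrt s * gpdf _ = k * heat1 a s x); last by rewrite /heat1; ring.
rewrite (_ : (- k / Num.sqrt s) ^+ 2 / 2 * gpdf1 _ = k ^+ 2 / 2 * heat2 a s x); last first.
  rewrite /heat2 -[in X in _ = _ * (_ / X)](@sqr_sqrtr _ s) ?ltW//; field.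
  by rewrite gt_eqF.
move/le_trans; apply; rewrite -[leRHS]mulrA ler_wpM2l// normrM normrN exprMn mulrC.
rewrite ler_wpM2r ?exprn_ge0// normfV exprVn lef_pV2 ?posrE ?exprn_gt0 ?normr_gt0 ?lt0r_neq0//.
by rewrite lerXn2r ?nnegrE ?sqrtr_ge0// (ger0_norm (sqrtr_ge0 _)) ler_sqrt// ltW.
Qed.

(** Under the normal law the identity is a random variable with distribution function [gcdf];
    bounds, monotonicity and limits of [gcdf] are then those of [cdf]. *)
Let idRV : measurableTypeR R -> R := idfun.

#[local] HB.instance Definition _ :=
  @isMeasurableFun.Build _ _ _ _ idRV (@measurable_id _ _ setT).

Lemma gcdf_cdf z :
  (gcdf z)%:E = cdf (idRV : {RV (normal_prob (0 : R) 1) >-> R}) z.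
Proof. by rewrite gcdfE /cdf /distribution /pushforward preimage_id. Qed.

Lemma gcdf_ge0 z : 0 <= gcdf z.
Proof. by rewrite -lee_fin gcdf_cdf cdf_ge0. Qed.

Lemma gcdf_le1 z : gcdf z <= 1.
Proof. by rewrite -lee_fin gcdf_cdf cdf_le1. Qed.

Lemma gcdf_nondecreasing y z : y <= z -> gcdf y <= gcdf z.
Proof. by move=> yz; rewrite -lee_fin !gcdf_cdf; exact: cdf_nondecreasing. Qed.

Lemma gcdf_cvgy : gcdf z @[z --> +oo] --> (1 : R).
Proof.
have e : fine \o cdf (idRV : {RV (normal_prob (0 : R) 1) >-> R}) = gcdf.
  by apply/funext => z; rewrite /comp -gcdf_cdf.
rewrite -e; exact: (fine_cvg (cvg_cdfy1 _)).
Qed.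

Lemma gcdf_cvgNy : gcdf z @[z --> -oo] --> (0 : R).
Proof.
have e : fine \o cdf (idRV : {RV (normal_prob (0 : R) 1) >-> R}) = gcdf.
  by apply/funext => z; rewrite /comp -gcdf_cdf.
rewrite -e; exact: (fine_cvg (cvg_cdfNy0 _)).
Qed.

Lemma gcdf_lipschitz y z : `|gcdf z - gcdf y| <= gbound * `|z - y|.
Proof.
have := @mvt_le R gcdf gpdf y (z - y) gbound (fun _ _ => is_derive_gcdf _)
  (fun _ _ => gpdf_le _).
by rewrite subrKC.
Qed.

Lemma measurable_heat a s : measurable_fun setT (heat a s).
Proof.
apply: (measurableT_comp (f := gcdf)).
  apply: continuous_measurable_fun => z.
  by apply: differentiable_continuous; apply/derivable1_diffP; have [] := is_derive_gcdf z.
by apply: measurable_funM => //; exact: measurable_funB.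
Qed.

Lemma measurable_heat1 a s : measurable_fun setT (heat1 a s).
Proof.
apply: measurable_funM => //; apply: measurable_funN.
apply: (measurableT_comp (f := gpdf)); first exact: measurable_normal_pdf.
by apply: measurable_funM => //; exact: measurable_funB.
Qed.

Lemma measurable_heat2 a s : measurable_fun setT (heat2 a s).
Proof.
apply: measurable_funM => //; apply: (measurableT_comp (f := gpdf1)).
  by apply: measurable_funM; [exact: measurable_funN|exact: measurable_normal_pdf].
by apply: measurable_funM => //; exact: measurable_funB.
Qed.

Lemma heat_bound a s x : `|heat a s x| <= 1.
Proof. by rewrite ger0_norm ?gcdf_ge0// gcdf_le1. Qed.

Lemma heat1_bound a s x : `|heat1 a s x| <= gbound / Num.sqrt s.
Proof.
rewrite /heat1 normrM normrN (ger0_norm (_ : 0 <= _^-1)) ?invr_ge0//.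
by rewrite ler_wpM2r ?invr_ge0// gpdf_le.
Qed.

Lemma heat2_bound a s0 s x : 0 < s0 -> s0 <= s -> `|heat2 a s x| <= gbound / s0.
Proof.
move=> s00 s0s; have sp : 0 < s by exact: lt_le_trans s0s.
rewrite /heat2 normrM (ger0_norm (_ : 0 <= s^-1)) ?invr_ge0 ?(ltW sp)//.
by rewrite ler_pM ?gpdf1_le ?invr_ge0 ?(ltW sp)// lef_pV2.
Qed.

End gaussian.

(** * Elementary inequalities, parities of row indices and counting of pairs *)

Lemma invsqrt_dist (R : realType) (s : R) : 2^-1 <= s -> `|(Num.sqrt s)^-1 - 1| <= 2 * `|s - 1|.
Proof.
move=> s2; have s0 : 0 < s by apply: lt_le_trans s2; rewrite invr_gt0.
have q0 : 0 < Num.sqrt s by rewrite sqrtr_gt0.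
have e : s - 1 = (Num.sqrt s - 1) * (Num.sqrt s + 1).
  by rewrite -[in LHS](@sqr_sqrtr _ s) ?(ltW s0)//; ring.
have -> : (Num.sqrt s)^-1 - 1 = - ((Num.sqrt s)^-1 * (Num.sqrt s - 1)) by field; rewrite gt_eqF.
rewrite normrN normrM e normrM (ger0_norm (_ : 0 <= _^-1)) ?invr_ge0//.
rewrite (ger0_norm (_ : 0 <= Num.sqrt s + 1)) ?addr_ge0//.
rewrite mulrCA [leLHS]mulrC ler_wpM2l// -div1r ler_pdivrMr//.
rewrite [leRHS](_ : _ = 2 * (Num.sqrt s ^+ 2 + Num.sqrt s)); last by ring.
by rewrite sqr_sqrtr ?(ltW s0)//; lra.
Qed.

(* The largest row index [v] that is not common to both terms occurs an odd number
   of times; [a] and [b] stand for the rows t - h and t - h', which occur in both. *)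
Lemma qterm_parity h h' s s' r r' a b : (0 < h)%N -> (0 < h')%N ->
  (h < s)%N -> (h' < s')%N -> (h < r)%N -> (h' < r')%N ->
  (s' < s)%N -> (r' < r)%N -> ~~ ((s == r) && (s' == r')) ->
  let v := if s == r then maxn s' r' else maxn s r in
  odd ((s - h == v) + (a == v) + ((s' - h' == v) + (b == v) + ((s == v) + (s' == v) +
      ((r - h == v) + (a == v) + ((r' - h' == v) + (b == v) +
        ((r == v) + (r' == v) + 0))))))%N.
Proof.
move=> h0 h'0 hs hs' hr hr' lts ltr ne.
have F (i j : nat) : (i < j)%N -> (i == j) = false by move=> ij; rewrite ltn_eqF.
have sub i j : (0 < j)%N -> (j < i)%N -> (i - j < i)%N by lia.
have [sr|sr] := eqVneq s r => /=.
  subst r; move: ne; rewrite eqxx /= => ne.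
  case: (ltngtP s' r') => [s'r'|s'r'|e]; last by rewrite e eqxx in ne.
    rewrite eqxx (F _ _ s'r') (F (r' - h')%N) ?(F (s' - h')%N) ?(gtn_eqF ltr) /=.
    - by case: (_ == _); case: (_ == _); case: (_ == _).
    - by apply: ltn_trans s'r'; exact: sub.
    - exact: sub.
  rewrite eqxx (F _ _ s'r') (F (r' - h')%N) ?(F (s' - h')%N) ?(gtn_eqF lts) /=.
  - by case: (_ == _); case: (_ == _); case: (_ == _).
  - exact: sub.
  - by apply: ltn_trans s'r'; exact: sub.
case: (ltngtP s r) => [s_r|s_r|e]; last by rewrite e eqxx in sr.
  rewrite eqxx (F _ _ s_r) (F _ _ ltr) (F _ _ (ltn_trans lts s_r)) (F (s - h)%N)
    ?(F (s' - h')%N) ?(F (r - h)%N) ?(F (r' - h')%N) /=.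
  - by case: (_ == _); case: (_ == _).
  - by apply: ltn_trans ltr; exact: sub.
  - exact: sub.
  - by apply: ltn_trans (ltn_trans lts s_r); exact: sub.
  - by apply: ltn_trans s_r; exact: sub.
rewrite eqxx (F _ _ s_r) (F _ _ lts) (F _ _ (ltn_trans ltr s_r)) (F (s - h)%N)
  ?(F (s' - h')%N) ?(F (r - h)%N) ?(F (r' - h')%N) /=.
- by case: (_ == _); case: (_ == _).
- by apply: ltn_trans (ltn_trans ltr s_r); exact: sub.
- by apply: ltn_trans s_r; exact: sub.
- by apply: ltn_trans lts; exact: sub.
- exact: sub.
Qed.

(** Among s - h, s - h', r - h and r - h' the largest is [v], attained once because s <> r and h <>
    h'. The rows [a] and [b], standing for t - h and t - h', occur twice each and leave the parity
    alone. *)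
Lemma dterm_parity h h' s r a b : (0 < h)%N -> (0 < h')%N -> h != h' -> s != r ->
  (h < s)%N -> (h' < s)%N -> (h < r)%N -> (h' < r)%N ->
  let v := (maxn s r - minn h h')%N in
  odd ((s - h == v) + (a == v) + ((s - h' == v) + (b == v) +
      ((r - h == v) + (a == v) + ((r - h' == v) + (b == v) + 0))))%N.
Proof.
move=> h0 h'0 hh' sr hs hs' hr hr'.
have F (i j : nat) : (i < j)%N -> (i == j) = false by move=> ij; rewrite ltn_eqF.
have F' (i j : nat) : (j < i)%N -> (i == j) = false by move=> ij; rewrite gtn_eqF.
case: (ltngtP s r) sr => // sr _; case: (ltngtP h h') hh' => // hh' _ /=;
  rewrite eqxx.
- rewrite (F (s - h)%N) ?(F (s - h')%N) ?(F (r - h')%N) /=;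
    [by case: (_ == _); case: (_ == _)|lia..].
- rewrite (F (s - h)%N) ?(F (s - h')%N) ?(F (r - h)%N) /=;
    [by case: (_ == _); case: (_ == _)|lia..].
- rewrite (F (r - h)%N) ?(F (r - h')%N) ?(F (s - h')%N) /=;
    [by case: (_ == _); case: (_ == _)|lia..].
- rewrite (F (r - h)%N) ?(F (r - h')%N) ?(F (s - h)%N) /=;
    [by case: (_ == _); case: (_ == _)|lia..].
Qed.

Lemma sqr_sum_le (R : realFieldType) (I : finType) (a : I -> R) :
  (\sum_i a i) ^+ 2 <= #|I|%:R * \sum_i a i ^+ 2.
Proof.
set S := \sum_i a i; set N : R := #|I|%:R.
have [I0|I0] := eqVneq #|I| 0%N.
  have e (f : I -> R) : \sum_i f i = 0
    by rewrite big1// => i; have := max_card (pred1 i); rewrite card1 I0.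
  by rewrite /S !e expr0n mulr0.
have N0 : 0 < N by rewrite ltr0n lt0n.
have : 0 <= \sum_i (N * a i - S) ^+ 2 by apply: sumr_ge0 => i _; exact: sqr_ge0.
have -> : \sum_i (N * a i - S) ^+ 2 = N * (N * \sum_i a i ^+ 2 - S ^+ 2).
  rewrite (eq_bigr (fun i => N ^+ 2 * a i ^+ 2 + (- (2 * N * S) * a i + S ^+ 2))); last first.
    by move=> i _; ring.
  rewrite big_split big_split /= -!mulr_sumr -/S sumr_const -[_ *+ _]mulr_natl -/N; ring.
by rewrite pmulr_rge0// subr_ge0.
Qed.

Lemma sum_lt_ord l m : (\sum_(s < m) (l < s)%N = m - l.+1)%N.
Proof.
elim: m => [|m IH]; first by rewrite big_ord0.
by rewrite big_ord_recr /= IH; case: ltnP => lm; lia.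
Qed.

(** This counts the pairs behind the total variance in [sum_vtime]. Truncated subtraction keeps it
    true for m <= l. *)
Lemma sum_sum_lt_ord l m :
  (2 * (\sum_(i < m) \sum_(s < i.+1) (l < s)%N) = (m - l) * (m - l).-1)%N.
Proof.
elim: m => [|m IH]; first by rewrite big_ord0.
rewrite big_ord_recr /= mulnDr IH sum_lt_ord subSS.
have [lm|lm] := leqP l m; last by rewrite (_ : (m.+1 - l = 0)%N); lia.
by rewrite subSn//=; case: (m - l)%N => //= k; nia.
Qed.

(** * The array of directions *)

Section array.
Context (R : realType) (p n : nat).
Hypothesis p_gt0 : (0 < p)%N.
Local Notation vec := 'cV[R]_p.
Local Notation vecT := (vecT R p).
Local Notation arrT := (arrT R p n).
Variables (mu : probability vecT R) (Q : probability arrT R).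
Hypothesis mu0 : mu [set 0] = 0%E.
Hypothesis mu_rot : forall (O : 'M[R]_p) (B : set vec), orthogonal_mx O ->
  vborel B -> mu ((fun v => udir v) @^-1` B) = mu ((fun v => O *m udir v) @^-1` B).
Hypothesis Q_prod : forall B : nat -> set vec, (forall t, vborel (B t)) ->
  Q (cyl n B) = (\prod_(1 <= t < n.+1) mu (B t))%E.
Implicit Types (x : nat -> vec) (t v : nat).

(* Rows outside 1, ..., n get a constant unit vector, so that all rows are measurable. *)
Definition sdir t x : vec := if (1 <= t <= n)%N then usph (x t) else uref R p.

Definition gram x a b : R := dot (sdir a x) (sdir b x).

Lemma sdir_unit t x : dot (sdir t x) (sdir t x) = 1.
Proof. by rewrite /sdir; case: ifP => _; [exact: dot_usph|exact: dot_uref]. Qed.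

Lemma gramC x a b : gram x a b = gram x b a.
Proof. exact: dotC. Qed.

Lemma gramxx x a : gram x a a = 1.
Proof. exact: sdir_unit. Qed.

Lemma sdir_upd t v x z : (1 <= v <= n)%N ->
  sdir t (upd x v z) = if t == v then usph z else sdir t x.
Proof. by move=> vn; rewrite /sdir /upd; case: eqVneq => // ->; rewrite vn. Qed.

Lemma bmf_sdir t (i : 'I_p) : bmf (fun x : arrT => sdir t x i ord0).
Proof.
have [tn|tn] := boolP (1 <= t <= n)%N; last first.
  rewrite (_ : (fun x : arrT => _) = fun=> uref R p i ord0); first exact: bmf_cst.
  by apply/funext => x; rewrite /sdir (negPf tn).
rewrite (_ : (fun x : arrT => _) = fun x : arrT => usph (x t) i ord0); last first.
  by apply/funext => x; rewrite /sdir tn.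
split; last by exists 1 => x; exact: usph_le1.
have [m _] := bmf_usph R p_gt0 i.
exact: (measurableT_comp m (@measurable_entry R p n t tn)).
Qed.

Lemma bmf_dot (Y Z : arrT -> vec) : (forall i, bmf (fun x : arrT => Y x i ord0)) ->
  (forall i, bmf (fun x : arrT => Z x i ord0)) -> bmf (fun x : arrT => dot (Y x) (Z x)).
Proof. by move=> bY bZ; apply: bmf_sum => i _; exact: bmfM. Qed.

Lemma bmf_gram a b : bmf (fun x : arrT => gram x a b).
Proof. by apply: bmf_dot => i; exact: bmf_sdir. Qed.

Lemma bmf_upd v x (F : arrT -> R) : (1 <= v <= n)%N -> bmf F ->
  bmf (fun z : vecT => F (upd x v z)).
Proof.
move=> vn [mF [M hM]]; split; last by exists M => z; exact: hM.
apply: (measurableT_comp mF).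
have m : measurable_fun setT (fun xz : arrT * vecT => upd xz.1 v xz.2 : arrT).
  exact: measurable_upd.
exact: (measurableT_comp m (measurable_pair1 (x : arrT))).
Qed.

Lemma mean_resample v (F g : arrT -> R) : (1 <= v <= n)%N -> bmf F ->
  (forall x, \int[mu]_z F (upd x v z) = g x) ->
  \int[Q]_x F x = \int[Q]_x g x.
Proof.
move=> vn bF Fg; rewrite (resample Q_prod vn bF).2.
by apply: eq_Rintegral => x _; rewrite Fg.
Qed.

(** A function of the rows before [t] is free of every row from [t] on; this is how adaptedness is
    expressed. *)
Definition free v (S : Type) (A : (nat -> vec) -> S) := forall x z, A (upd x v z) = A x.

Lemma free_sdir v t : (1 <= v <= n)%N -> t != v -> free v (sdir t).
Proof. by move=> vn tv x z; rewrite sdir_upd// (negPf tv). Qed.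

Lemma free_gram v a b : (1 <= v <= n)%N -> a != v -> b != v ->
  free v (fun x => gram x a b).
Proof. by move=> vn av bv x z; rewrite /gram !free_sdir. Qed.

Section dot_moments.
Variables (v : nat) (A : arrT -> R) (Y : arrT -> vec).
Hypothesis vn : (1 <= v <= n)%N.
Hypotheses (bA : bmf A) (bY : forall i, bmf (fun x : arrT => Y x i ord0)).
Hypotheses (fA : free v A) (fY : free v Y).

Lemma bmf_dot_sdir : bmf (fun x : arrT => dot (sdir v x) (Y x)).
Proof. by apply: bmf_dot => // i; exact: bmf_sdir. Qed.

(** Neither [A] nor [Y] involves row [v], so integrating that row first leaves a moment of the
    uniform law in the fixed direction [Y x]. *)
Lemma mean_dot_moment k :
  \int[Q]_x (A x * dot (sdir v x) (Y x) ^+ k) = \int[Q]_x (A x * moment mu k (Y x)).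
Proof.
apply: (mean_resample vn).
  by apply: bmfM => //; apply: bmfX; exact: bmf_dot_sdir.
move=> x; rewrite -meanZ; last exact/bmfX/bmf_dot_usph.
by apply: eq_Rintegral => z _; rewrite fA fY sdir_upd// eqxx.
Qed.

Lemma mean_dot1 : \int[Q]_x (A x * dot (sdir v x) (Y x)) = 0.
Proof.
have := mean_dot_moment 1; rewrite (eq_Rintegral _ (g := fun x : arrT =>
  A x * dot (sdir v x) (Y x))).
  move=> ->; rewrite -[RHS](mean_cst Q); apply: eq_Rintegral => x _.
  by rewrite moment1// mulr0.
by move=> x _; rewrite expr1.
Qed.

Lemma mean_dot_even j :
  \int[Q]_x (A x * dot (sdir v x) (Y x) ^+ (2 * j)) =
  dirm mu (2 * j) * \int[Q]_x (A x * dot (Y x) (Y x) ^+ j).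
Proof.
rewrite mean_dot_moment -meanZ; last by apply: bmfM => //; apply: bmfX; exact: bmf_dot.
by apply: eq_Rintegral => x _; rewrite (moment_even p_gt0 mu0 mu_rot); ring.
Qed.

End dot_moments.

Lemma mean_gram_even v b j (A : arrT -> R) : (1 <= v <= n)%N -> b != v ->
  bmf A -> free v A ->
  \int[Q]_x (A x * gram x v b ^+ (2 * j)) = dirm mu (2 * j) * \int[Q]_x A x.
Proof.
move=> vn bv bA fA; rewrite (mean_dot_even (Y := sdir b))//.
- by congr (_ * _); apply: eq_Rintegral => x _; rewrite sdir_unit expr1n mulr1.
- by move=> i; exact: bmf_sdir.
- exact: free_sdir.
Qed.

Lemma mean_gram_pow v b j : (1 <= v <= n)%N -> b != v ->
  \int[Q]_x gram x v b ^+ (2 * j) = dirm mu (2 * j).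
Proof.
move=> vn bv; have := @mean_gram_even v b j (fun=> 1) vn bv (bmf_cst _ 1) (fun _ _ => erefl).
rewrite mean_cst mulr1 => <-.
by apply: eq_Rintegral => x _; rewrite mul1r.
Qed.

(** A product of inner products is read as a multigraph on the rows with edge list [l]; this is the
    degree of vertex [v], a loop counting twice. *)
Definition deg v (l : seq (nat * nat)) := (\sum_(e <- l) ((e.1 == v) + (e.2 == v)))%N.

Lemma bmf_gram_prod (l : seq (nat * nat)) :
  bmf (fun x : arrT => \prod_(e <- l) gram x e.1 e.2).
Proof.
elim: l => [|e l IH].
  have -> : (fun x : arrT => \prod_(e <- [::]) gram x e.1 e.2) = fun=> 1.
    by apply/funext => x; rewrite big_nil.
  exact: bmf_cst.
have := bmfM (bmf_gram e.1 e.2) IH.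
by congr bmf; apply/funext => x; rewrite big_cons.
Qed.

(* Flipping the sign of row [v] changes the sign of a product of inner products in
   which row [v] occurs an odd number of times. *)
Lemma mean_gram_odd v (l : seq (nat * nat)) : (1 <= v <= n)%N -> odd (deg v l) ->
  \int[Q]_x \prod_(e <- l) gram x e.1 e.2 = 0.
Proof.
move=> vn odd_l; rewrite -[RHS](mean_cst Q).
apply: (mean_resample vn); first exact: bmf_gram_prod.
move=> x.
pose sd u t := if t == v then u else sdir t x.
pose g u := \prod_(e <- l) dot (sd u e.1) (sd u e.2).
have gE z : \prod_(e <- l) gram (upd x v z) e.1 e.2 = g (usph z).
  by apply: eq_bigr => e _; rewrite /gram /sd !sdir_upd.
have gN u : g (- u) = - g u.
  have s1 : (-1 : R) = (-1) ^+ deg v l by rewrite -signr_odd odd_l expr1.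
  rewrite -[RHS]mulN1r [X in X * _]s1 /g /deg.
  elim: (l) => [|e k IH]; first by rewrite !big_nil expr0 mul1r.
  rewrite !big_cons IH !exprD /sd.
  by case: eqP => _; case: eqP => _; rewrite ?dotNl ?dotNr ?expr0 ?expr1; ring.
have bg : bmf (fun z : vecT => g (usph z)).
  have := bmf_upd x vn (bmf_gram_prod l).
  by congr bmf; apply/funext => z; rewrite gE.
rewrite (eq_Rintegral _ (g := fun z : vecT => g (usph z))); last by move=> z _; exact: gE.
have e := mean_usph_opp p_gt0 mu0 mu_rot bg.
have : \int[mu]_z g (usph z) = - \int[mu]_z g (usph z).
  rewrite {1}e -mulN1r -meanZ//.
  by apply: eq_Rintegral => z _; rewrite gN mulN1r.
lra.
Qed.

Lemma orth_sum (I : finType) (Pr : pred I) (m : I -> arrT -> R) (K : R) :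
  (forall i, bmf (m i)) ->
  (forall i j, Pr i -> Pr j -> i != j -> \int[Q]_x (m i x * m j x) = 0) ->
  (forall i, Pr i -> \int[Q]_x (m i x ^+ 2) <= K) ->
  \int[Q]_x ((\sum_(i | Pr i) m i x) ^+ 2) <= K *+ #|Pr|.
Proof.
move=> bm orth mK.
rewrite (eq_Rintegral _ (g := fun x : arrT => \sum_(i | Pr i) \sum_(j | Pr j) m i x * m j x)).
  rewrite mean_sum; last by move=> i _; apply: bmf_sum => j _; exact: bmfM.
  rewrite -sumr_const; apply: ler_sum => i Pi.
  rewrite mean_sum; last by move=> j _; exact: bmfM.
  rewrite (bigD1 i)//= big1 ?addr0.
    by apply: le_trans (mK i Pi); rewrite le_eqVlt; apply/orP; left;
      apply/eqP; apply: eq_Rintegral => x _; rewrite expr2.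
  by move=> j /andP[Pj ji]; apply: orth => //; rewrite eq_sym.
move=> x _; rewrite expr2 mulr_suml; apply: eq_bigr => i _.
by rewrite mulr_sumr.
Qed.

(** The value 0 for s <= h, where s - h would be truncated, lets the sums over [s] have the same
    range for all lags. *)
Definition lagc t h s x : R := if (h < s)%N then gram x (s - h) (t - h) else 0.

Lemma bmf_lagc t h s : bmf (lagc t h s : arrT -> R).
Proof.
have [hs|hs] := boolP (h < s)%N.
  have := bmf_gram (s - h) (t - h).
  by congr bmf; apply/funext => x; rewrite /lagc hs.
have := bmf_cst arrT (0 : R).
by congr bmf; apply/funext => x; rewrite /lagc (negPf hs).
Qed.

Section fixed_time.
Variable t : nat.
Hypothesis tn : (t <= n)%N.

Definition qterm h h' (e : 'I_t * 'I_t) x : R :=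
  lagc t h e.1 x * lagc t h' e.2 x * gram x e.1 e.2.

Lemma bmf_qterm h h' e : bmf (qterm h h' e : arrT -> R).
Proof. by apply: bmfM; [apply: bmfM; exact: bmf_lagc|exact: bmf_gram]. Qed.

(** The product of two terms is a graph with six edges in which some vertex has odd degree. The
    single terms are not all centred: if h' < h and h + h' < t, the pair s = t - h', s' = t - h
    gives a triangle, of mean p^-2. Orthogonality alone bounds the second moment of the sum. *)
Lemma qterm_orth h h' (e e' : 'I_t * 'I_t) : (0 < h)%N -> (0 < h')%N ->
  (e.2 < e.1)%N -> (e'.2 < e'.1)%N -> e != e' ->
  \int[Q]_x (qterm h h' e x * qterm h h' e' x) = 0.
Proof.
case: e e' => [[s st] [s' s't]] [[r rt] [r' r't]] h0 h'0 /= lt_s lt_r ne.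
have {}ne : ~~ ((s == r) && (s' == r')).
  by apply: contra ne => /andP[/eqP sr /eqP s'r']; apply/eqP; congr (_, _); exact: val_inj.
have zero (F : arrT -> R) : (forall x, F x = 0) -> \int[Q]_x F x = 0.
  by move=> F0; rewrite -[RHS](mean_cst Q); apply: eq_Rintegral => x _.
rewrite /qterm /lagc /=.
case: (ltnP h s) => hs; last by apply: zero => x; rewrite !mul0r.
case: (ltnP h' s') => hs'; last by apply: zero => x; rewrite !(mulr0, mul0r).
case: (ltnP h r) => hr; last by apply: zero => x; rewrite !(mulr0, mul0r).
case: (ltnP h' r') => hr'; last by apply: zero => x; rewrite !(mulr0, mul0r).
pose l := [:: (s - h, t - h); (s' - h', t - h'); (s, s');
              (r - h, t - h); (r' - h', t - h'); (r, r')]%N.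
pose v := if s == r then maxn s' r' else maxn s r.
have vn : (1 <= v <= n)%N by rewrite /v; case: eqP => _; lia.
have := @mean_gram_odd v l vn.
have -> : odd (deg v l).
  rewrite /deg !big_cons big_nil /= /v.
  exact: qterm_parity.
move=> <- //; apply: eq_Rintegral => x _.
by rewrite !big_cons big_nil /=; ring.
Qed.

(** Passing to separate sixth powers avoids the joint law of the three inner products of a [qterm],
    which may share rows. It is the inequality of arithmetic and geometric means for the three
    squares. *)
Lemma prod3_sqr_le (a b c : R) :
  (a * b * c) ^+ 2 <= 3^-1 * (a ^+ 6 + (b ^+ 6 + c ^+ 6)).
Proof.
rewrite !exprMn (exprM _ 2 3) (exprM b 2 3) (exprM c 2 3).
move: (sqr_ge0 a) (sqr_ge0 b) (sqr_ge0 c).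
move: (a ^+ 2) (b ^+ 2) (c ^+ 2) => X Y Z X0 Y0 Z0.
have : 0 <= (X + Y + Z) * ((X - Y) ^+ 2 + (Y - Z) ^+ 2 + (Z - X) ^+ 2).
  by rewrite mulr_ge0 ?addr_ge0 ?sqr_ge0.
rewrite (_ : (X + Y + Z) * _ = 2 * (X ^+ 3 + Y ^+ 3 + Z ^+ 3) - 6 * (X * Y * Z)); last by ring.
lra.
Qed.

Lemma qterm_sqr h h' (e : 'I_t * 'I_t) : (0 < h)%N -> (0 < h')%N -> (e.2 < e.1)%N ->
  \int[Q]_x (qterm h h' e x ^+ 2) <= dirm mu 6.
Proof.
case: e => [[s st] [s' s't]] h0 h'0 /= lt_s.
have d60 : 0 <= dirm mu 6 by apply: mean_ge0 => v; rewrite exprn_even_ge0.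
have [hs|hs] := boolP ((h < s) && (h' < s'))%N; last first.
  rewrite (eq_Rintegral _ (g := fun=> 0)) ?mean_cst// => x _.
  rewrite /qterm /lagc /=; move: hs; rewrite negb_and.
  by case/orP => /negPf ->; rewrite ?mulr0 !mul0r expr0n.
move/andP : hs => [hs hs'].
have b6 a b := bmfX 6 (bmf_gram a b).
pose F x := 3^-1 * (gram x (s - h) (t - h) ^+ 6 +
   (gram x (s' - h') (t - h') ^+ 6 + gram x s s' ^+ 6)).
have bS := bmfD (b6 (s' - h')%N (t - h')%N) (b6 s s').
apply: (@le_trans _ _ (\int[Q]_x F x)).
  apply: mean_le; [apply: bmfX; exact: bmf_qterm|apply: bmfZ; exact: bmfD|].
  by move=> x; rewrite /qterm /lagc /= hs hs'; exact: prod3_sqr_le.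
rewrite /F meanZ ?meanD//; last exact: bmfD.
have E a b : (1 <= a <= n)%N -> b != a -> \int[Q]_x (gram x a b ^+ 6) = dirm mu 6.
  move=> an ba; exact: (@mean_gram_pow a b 3 an ba).
rewrite !E; [lra|lia..].
Qed.

Lemma qterm_offdiag h h' : (0 < h)%N -> (0 < h')%N ->
  \int[Q]_x ((\sum_(e : 'I_t * 'I_t | (e.2 < e.1)%N) qterm h h' e x) ^+ 2)
  <= t%:R ^+ 2 * dirm mu 6.
Proof.
move=> h0 h'0; have d60 : 0 <= dirm mu 6 by apply: mean_ge0 => v; rewrite exprn_even_ge0.
apply: le_trans.
  apply: (@orth_sum _ (fun e : 'I_t * 'I_t => (e.2 < e.1)%N) _ (dirm mu 6)).
  - by move=> e; exact: bmf_qterm.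
  - by move=> e e' He He' ne; exact: qterm_orth.
  - by move=> e He; exact: qterm_sqr.
rewrite -[_ *+ #|_|]mulr_natl ler_wpM2r// -natrX ler_nat.
apply: (leq_trans (max_card _)).
by rewrite card_prod card_ord mulnn.
Qed.

(** The diagonal term s = s' of [qform], where [gram] is 1, minus its mean: 1/p for equal lags with
    h < s, by [dirm2], and 0 otherwise. *)
Definition dterm h h' s x : R :=
  lagc t h s x * lagc t h' s x - ((h == h') && (h < s)%N)%:R / p%:R.

Lemma bmf_dterm h h' s : bmf (dterm h h' s : arrT -> R).
Proof. by apply: bmfB; [apply: bmfM; exact: bmf_lagc|exact: bmf_cst]. Qed.

Let mean_zero (F : arrT -> R) : (forall x, F x = 0) -> \int[Q]_x F x = 0.
Proof. by move=> F0; rewrite -[RHS](mean_cst Q); apply: eq_Rintegral => x _. Qed.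

(** For equal lags, row s - h is absent from the factor of [r], and integrating it first turns the
    squared inner product into its mean 1/p. For unequal lags some row has odd degree. *)
Lemma dterm_orth h h' s r : (0 < h)%N -> (0 < h')%N -> (s < t)%N -> (r < t)%N ->
  s != r -> \int[Q]_x (dterm h h' s x * dterm h h' r x) = 0.
Proof.
move=> h0 h'0 st rt sr; have [e|hh'] := eqVneq h h'.
  subst h'; rewrite /dterm eqxx /= /lagc.
  case: (ltnP h s) => hs; last by apply: mean_zero => x; rewrite !(mul0r, mulr0, subr0).
  case: (ltnP h r) => hr; last by apply: mean_zero => x; rewrite !(mul0r, mulr0, subr0).
  pose D x := gram x (r - h) (t - h) * gram x (r - h) (t - h) - 1 / p%:R.
  have bD : bmf (D : arrT -> R).
    by apply: bmfB; [apply: bmfM; exact: bmf_gram|exact: bmf_cst].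
  have vn : (1 <= s - h <= n)%N by lia.
  have tv : (t - h)%N != (s - h)%N by lia.
  have rv : (r - h)%N != (s - h)%N by lia.
  have fD : free (s - h) D.
    move=> x z; rewrite /D free_gram//.
  have e := mean_gram_even 1 vn tv bD fD.
  have bG := bmfM bD (bmfX (2 * 1) (bmf_gram (s - h) (t - h))).
  rewrite (eq_Rintegral _ (g := fun x : arrT => D x * gram x (s - h) (t - h) ^+ (2 * 1)
      - (1 / p%:R) * D x)); last by move=> x _; rewrite /D /=; ring.
  rewrite meanB//; last exact: bmfZ.
  by rewrite e meanZ// (dirm2 p_gt0 mu0 mu_rot); ring.
rewrite /dterm (negPf hh') /= /lagc.
case: (ltnP h s) => hs; last by apply: mean_zero => x; rewrite !(mul0r, mulr0, subr0).
case: (ltnP h' s) => hs'; last by apply: mean_zero => x; rewrite !(mul0r, mulr0, subr0).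
case: (ltnP h r) => hr; last by apply: mean_zero => x; rewrite !(mul0r, mulr0, subr0).
case: (ltnP h' r) => hr'; last by apply: mean_zero => x; rewrite !(mul0r, mulr0, subr0).
pose l := [:: (s - h, t - h); (s - h', t - h'); (r - h, t - h); (r - h', t - h')]%N.
pose v := (maxn s r - minn h h')%N.
have vn : (1 <= v <= n)%N by rewrite /v; lia.
have := @mean_gram_odd v l vn.
have -> : odd (deg v l).
  rewrite /deg !big_cons big_nil /=; exact: dterm_parity.
move=> <- //; apply: eq_Rintegral => x _.
by rewrite !big_cons big_nil /=; ring.
Qed.

Lemma dterm_sqr h h' s : (0 < h)%N -> (0 < h')%N -> (s < t)%N ->
  \int[Q]_x (dterm h h' s x ^+ 2) <= dirm mu 4.
Proof.
move=> h0 h'0 st.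
have d40 : 0 <= dirm mu 4 by apply: mean_ge0 => v; rewrite exprn_even_ge0.
have bG k a b := bmfX k (bmf_gram a b).
have E k a b : (1 <= a <= n)%N -> b != a ->
    \int[Q]_x (gram x a b ^+ (2 * k)) = dirm mu (2 * k).
  move=> an ba; exact: (@mean_gram_pow a b k an ba).
have [e|hh'] := eqVneq h h'.
  subst h'; rewrite /dterm eqxx /= /lagc.
  case: (ltnP h s) => hs; last by rewrite mean_zero// => x; rewrite !(mul0r, mulr0, subr0) expr0n.
  set a := (s - h)%N; set b := (t - h)%N.
  rewrite (eq_Rintegral _ (g := fun x : arrT => gram x a b ^+ 4 +
    (- (2 / p%:R) * gram x a b ^+ 2 + (1 / p%:R) ^+ 2))); last by move=> x _ /=; ring.
  have b2 := bmfZ (- (2 / p%:R)) (bG 2 a b); have bc := bmf_cst arrT ((1 / p%:R : R) ^+ 2).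
  rewrite meanD//; last exact: bmfD.
  rewrite meanD// meanZ// mean_cst.
  rewrite (E 2) ?(E 1)//; [|rewrite /a /b; lia..].
  rewrite (_ : (2 * 1)%N = 2)// (dirm2 p_gt0 mu0 mu_rot).
  have : 0 <= (1 / p%:R : R) ^+ 2 by exact: sqr_ge0.
  rewrite (_ : (2 * 2)%N = 4)//; move: (dirm mu 4) => d; rewrite div1r expr2; lra.
rewrite /dterm (negPf hh') /= /lagc.
case: (ltnP h s) => hs; last by rewrite mean_zero// => x; rewrite !(mul0r, mulr0, subr0) expr0n.
case: (ltnP h' s) => hs'; last by rewrite mean_zero// => x; rewrite !(mul0r, mulr0, subr0) expr0n.
have bS := bmfD (bG 4 (s - h) (t - h))%N (bG 4 (s - h') (t - h'))%N.
apply: (@le_trans _ _ (\int[Q]_x (2^-1 *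
   (gram x (s - h) (t - h) ^+ 4 + gram x (s - h') (t - h') ^+ 4)))).
  apply: mean_le; [|exact: bmfZ|].
    by apply: bmfX; apply: bmfB; [apply: bmfM; exact: bmf_gram|exact: bmf_cst].
  move=> x; rewrite mul0r subr0.
  move: (gram x _ _) (gram x _ _) => a b.
  have : 0 <= (a ^+ 2 - b ^+ 2) ^+ 2 by exact: sqr_ge0.
  rewrite (_ : (_ - _) ^+ 2 = a ^+ 4 + b ^+ 4 - 2 * (a * b) ^+ 2); last by ring.
  lra.
by rewrite meanZ ?meanD// (E 2) ?(E 2); [rewrite (_ : (2 * 2)%N = 4)//; lra|lia..].
Qed.

Lemma dterm_sum h h' : (0 < h)%N -> (0 < h')%N ->
  \int[Q]_x ((\sum_(s < t) dterm h h' s x) ^+ 2) <= t%:R * dirm mu 4.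
Proof.
move=> h0 h'0; apply: le_trans.
  apply: (@orth_sum _ predT (fun s : 'I_t => dterm h h' s) (dirm mu 4)).
  - by move=> e; exact: bmf_dterm.
  - by move=> e e' _ _ ne; apply: dterm_orth.
  - by move=> e _; apply: dterm_sqr.
by rewrite -[_ *+ #|_|]mulr_natl cardT size_enum_ord.
Qed.

(** The inner product of the lag-h and lag-h' parts of [ivec], before weighting (see [dot_ivec]). *)
Definition qform h h' x : R :=
  \sum_(s < t) \sum_(s' < t) lagc t h s x * lagc t h' s' x * gram x s s'.

Lemma bmf_qform h h' : bmf (qform h h' : arrT -> R).
Proof.
apply: bmf_sum => s _; apply: bmf_sum => s' _.
by apply: bmfM; [apply: bmfM; exact: bmf_lagc|exact: bmf_gram].
Qed.

(** Transposing the pairs with s < s' exchanges the two lags, so both off-diagonal sums run over s'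
    < s, the range where [qterm_orth] applies. *)
Lemma qformE h h' x : qform h h' x =
  (\sum_(s < t) dterm h h' s x + (h == h')%:R / p%:R * \sum_(s < t) (h < s)%:R) +
  (\sum_(e : 'I_t * 'I_t | (e.2 < e.1)%N) qterm h h' e x +
   \sum_(e : 'I_t * 'I_t | (e.2 < e.1)%N) qterm h' h e x).
Proof.
rewrite /qform pair_bigA /= (bigID (fun e : 'I_t * 'I_t => e.2 == e.1)) /=.
congr (_ + _).
  rewrite -(pair_big_dep predT (fun s s' : 'I_t => s' == s)
    (fun s s' : 'I_t => lagc t h s x * lagc t h' s' x * gram x s s')) /=.
  rewrite mulr_sumr -big_split /=; apply: eq_bigr => s _.
  by rewrite big_pred1_eq gramxx mulr1 /dterm -mulnb natrM; ring.
rewrite (bigID (fun e : 'I_t * 'I_t => (e.2 < e.1)%N)) /=; congr (_ + _).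
  by apply: eq_bigl => e; rewrite -val_eqE /=; case: ltngtP.
rewrite (reindex_inj (h := fun e : 'I_t * 'I_t => (e.2, e.1))) /=; last first.
  by move=> [a b] [c d] /= [-> ->].
apply: eq_big => [e|e _].
  by rewrite -val_eqE /=; case: ltngtP.
by rewrite /qterm /= gramC; ring.
Qed.

(** Splitting into the diagonal and two off-diagonal sums costs the factor 3. By orthogonality they
    contribute orders t p^-2 and t^2 p^-3 instead of the squares of their numbers of terms. *)
Lemma qform_var h h' : (0 < h)%N -> (0 < h')%N ->
  \int[Q]_x ((qform h h' x - (h == h')%:R / p%:R * \sum_(s < t) (h < s)%:R) ^+ 2) <=
  3 * (t%:R * dirm mu 4 + 2 * (t%:R ^+ 2 * dirm mu 6)).
Proof.
move=> h0 h'0.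
pose A x := \sum_(s < t) dterm h h' s x.
pose B x := \sum_(e : 'I_t * 'I_t | (e.2 < e.1)%N) qterm h h' e x.
pose C x := \sum_(e : 'I_t * 'I_t | (e.2 < e.1)%N) qterm h' h e x.
have bA : bmf (A : arrT -> R) by apply: bmf_sum => s _; exact: bmf_dterm.
have bB : bmf (B : arrT -> R) by apply: bmf_sum => s _; exact: bmf_qterm.
have bC : bmf (C : arrT -> R) by apply: bmf_sum => s _; exact: bmf_qterm.
have b2 F (bF : bmf F) := bmfX 2 (F := F : arrT -> R) bF.
have bS := bmfD (b2 _ bA) (bmfD (b2 _ bB) (b2 _ bC)).
apply: (@le_trans _ _ (\int[Q]_x (3 * (A x ^+ 2 + (B x ^+ 2 + C x ^+ 2))))).
  apply: mean_le; [|exact: bmfZ|].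
    by apply: bmfX; apply: bmfB; [exact: bmf_qform|exact: bmf_cst].
  move=> x; rewrite qformE -/(A x) -/(B x) -/(C x).
  rewrite [X in X ^+ 2](_ : _ = A x + B x + C x); last by ring.
  move: (A x) (B x) (C x) => a b c.
  have : 0 <= (a - b) ^+ 2 + (b - c) ^+ 2 + (c - a) ^+ 2 by rewrite !addr_ge0 ?sqr_ge0.
  rewrite (_ : _ + _ + _ = 3 * (a ^+ 2 + (b ^+ 2 + c ^+ 2)) - (a + b + c) ^+ 2); last by ring.
  lra.
rewrite meanZ// meanD ?meanD//; [|exact: b2..|by apply: bmfD; exact: b2].
have dA : \int[Q]_x (A x ^+ 2) <= _ := dterm_sum h0 h'0.
have dB : \int[Q]_x (B x ^+ 2) <= _ := qterm_offdiag h0 h'0.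
have dC : \int[Q]_x (C x ^+ 2) <= _ := qterm_offdiag h'0 h0.
move: dA dB dC; clearbody A B C.
move: (\int[Q]_x (A x ^+ 2)) (\int[Q]_x (B x ^+ 2)) (\int[Q]_x (C x ^+ 2)).
move: (t%:R * _) (t%:R ^+ 2 * _) => a b i j k ia jb kb.
lra.
Qed.

End fixed_time.
(** * Martingale increments and the Lindeberg telescoping *)

Section lags.
Variable H : nat.
Hypotheses (H_gt0 : (0 < H)%N) (H_lt_n : (H < n)%N).

Definition lagw h : R := (n - h)%:R^-1.

Definition ivec t x : vec :=
  \sum_(h < H) lagw h.+1 *: \sum_(s < t) lagc t h.+1 s x *: sdir s x.

Definition iscale : R := Num.sqrt (2 * p%:R ^+ 2) / Num.sqrt H%:R.

Definition incr t x : R := iscale * dot (sdir t x) (ivec t x).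

(** The coefficient is [iscale ^+ 2] times [dirm 2], the second moment of a direction. *)
Definition cvar t x : R := 2 * p%:R / H%:R * dot (ivec t x) (ivec t x).

(** The tau_t of the overview. From [dot_ivec] it keeps the means 1/p of the diagonal terms with
    equal lags, whose p^-1 cancels the p in [cvar]. Because of the triangles it need not be the
    exact expectation of [cvar] when H > 1. *)
Definition vtime t : R :=
  2 / H%:R * \sum_(h < H) lagw h.+1 ^+ 2 * \sum_(s < t) (h.+1 < s)%:R.

Lemma ivecE t x (i : 'I_p) : ivec t x i ord0 =
  \sum_(h < H) lagw h.+1 * \sum_(s < t) lagc t h.+1 s x * sdir s x i ord0.
Proof.
rewrite /ivec summxE; apply: eq_bigr => h _; rewrite mxE summxE.
by congr (_ * _); apply: eq_bigr => s _; rewrite mxE.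
Qed.

Lemma bmf_ivec t (i : 'I_p) : bmf (fun x : arrT => ivec t x i ord0).
Proof.
have : bmf (fun x : arrT =>
    \sum_(h < H) lagw h.+1 * \sum_(s < t) lagc t h.+1 s x * sdir s x i ord0).
  apply: bmf_sum => h _; apply: bmfZ; apply: bmf_sum => s _.
  by apply: bmfM; [exact: bmf_lagc|exact: bmf_sdir].
by congr bmf; apply/funext => x; rewrite ivecE.
Qed.

Lemma bmf_incr t : bmf (incr t : arrT -> R).
Proof.
by apply: bmfZ; apply: bmf_dot => i; [exact: bmf_sdir|exact: bmf_ivec].
Qed.

Lemma bmf_cvar t : bmf (cvar t : arrT -> R).
Proof. by apply: bmfZ; apply: bmf_dot => i; exact: bmf_ivec. Qed.

Lemma free_lagc v t h s : (1 <= v <= n)%N -> (0 < h)%N -> (t <= v)%N -> (s < t)%N ->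
  free v (lagc t h s).
Proof.
move=> vn h0 tv st x z; rewrite /lagc; case: ltnP => // hs.
by rewrite free_gram//; lia.
Qed.

Lemma free_ivec v t : (1 <= v <= n)%N -> (t <= v)%N -> free v (ivec t).
Proof.
move=> vn tv x z; apply: eq_bigr => h _; congr (_ *: _).
apply: eq_bigr => s _; have := ltn_ord s => st.
by rewrite (free_lagc vn)// free_sdir//; lia.
Qed.

Lemma free_incr v t : (1 <= v <= n)%N -> (t < v)%N -> free v (incr t).
Proof.
move=> vn tv x z; rewrite /incr (free_ivec vn (ltnW tv)) free_sdir//.
by rewrite ltn_eqF.
Qed.

Lemma iscale_sqr : iscale ^+ 2 = 2 * p%:R ^+ 2 / H%:R.
Proof. by rewrite exprMn exprVn !sqr_sqrtr// mulr_ge0 ?exprn_ge0. Qed.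

Section one_step.
Variable t : nat.
Hypothesis tn : (1 <= t <= n)%N.

Section weight.
Variable A : arrT -> R.
Hypotheses (bA : bmf A) (fA : free t A).

Lemma mean_incr : \int[Q]_x (A x * incr t x) = 0.
Proof.
have := mean_dot1 tn bA (bmf_ivec t) fA (free_ivec tn (leqnn t)).
move=> h; rewrite (eq_Rintegral _ (g := fun x : arrT =>
  iscale * (A x * dot (sdir t x) (ivec t x)))); last first.
  by move=> x _; rewrite /incr; ring.
rewrite meanZ ?h ?mulr0//; apply: bmfM => //.
by apply: bmf_dot => i; [exact: bmf_sdir|exact: bmf_ivec].
Qed.

Lemma mean_incr_sqr : \int[Q]_x (A x * incr t x ^+ 2) = \int[Q]_x (A x * cvar t x).
Proof.
have bd : bmf (fun x : arrT => dot (sdir t x) (ivec t x)).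
  by apply: bmf_dot => i; [exact: bmf_sdir|exact: bmf_ivec].
have bv : bmf (fun x : arrT => dot (ivec t x) (ivec t x)).
  by apply: bmf_dot => i; exact: bmf_ivec.
have h := mean_dot_even tn bA (bmf_ivec t) fA (free_ivec tn (leqnn t)) 1.
rewrite (eq_Rintegral _ (g := fun x : arrT =>
  iscale ^+ 2 * (A x * dot (sdir t x) (ivec t x) ^+ (2 * 1)))); last first.
  by move=> x _; rewrite /incr; ring.
rewrite meanZ; last by apply: bmfM => //; exact: bmfX.
rewrite h (_ : (2 * 1)%N = 2)// (dirm2 p_gt0 mu0 mu_rot) mulrA -meanZ; last first.
  by apply: bmfM => //; exact: bmfX.
apply: eq_Rintegral => x _; rewrite /cvar iscale_sqr expr1; field.
by rewrite !pnatr_eq0 -!lt0n p_gt0 H_gt0.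
Qed.

End weight.

(** The 3 is the Gaussian one: [dirm4] says that a direction has at most Gaussian kurtosis. *)
Lemma mean_incr4 : \int[Q]_x (incr t x ^+ 4) <= 3 * \int[Q]_x (cvar t x ^+ 2).
Proof.
have bd : bmf (fun x : arrT => dot (sdir t x) (ivec t x)).
  by apply: bmf_dot => i; [exact: bmf_sdir|exact: bmf_ivec].
have bv : bmf (fun x : arrT => dot (ivec t x) (ivec t x)).
  by apply: bmf_dot => i; exact: bmf_ivec.
have h := mean_dot_even tn (bmf_cst arrT (1 : R)) (bmf_ivec t)
  (fun _ _ => erefl) (free_ivec tn (leqnn t)) 2.
rewrite (eq_Rintegral _ (g := fun x : arrT =>
  iscale ^+ 4 * (1 * dot (sdir t x) (ivec t x) ^+ (2 * 2)))); last first.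
  by move=> x _; rewrite /incr; ring.
rewrite meanZ; last by apply: bmfM; [exact: bmf_cst|exact: bmfX].
rewrite h -[leRHS]meanZ; last by apply: bmfX; exact: bmf_cvar.
rewrite (eq_Rintegral _ (f := fun x : arrT => 3 * cvar t x ^+ 2) (g := fun x : arrT =>
  (3 * (2 * p%:R / H%:R) ^+ 2) * (1 * dot (ivec t x) (ivec t x) ^+ 2))); last first.
  by move=> x _; rewrite /cvar; ring.
rewrite [leRHS]meanZ; last by apply: bmfM; [exact: bmf_cst|exact: bmfX].
rewrite mulrA; apply: ler_wpM2r.
  by apply: mean_ge0 => x; rewrite mul1r sqr_ge0.
rewrite (_ : (2 * 2)%N = 4)// (exprM iscale 2 2) iscale_sqr.
have d4 := dirm4 p_gt0 mu0 mu_rot.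
apply: (le_trans (ler_wpM2l _ d4)); first by rewrite sqr_ge0.
rewrite le_eqVlt; apply/orP; left; apply/eqP; field.
by rewrite !pnatr_eq0 -!lt0n p_gt0 H_gt0.
Qed.

Lemma dot_ivec x : dot (ivec t x) (ivec t x) =
  \sum_(h < H) \sum_(h' < H) lagw h.+1 * lagw h'.+1 * qform t h.+1 h'.+1 x.
Proof.
rewrite {1}/ivec dot_suml; apply: eq_bigr => h _.
rewrite dotZl /ivec dot_sumr mulr_sumr; apply: eq_bigr => h' _.
rewrite dotZr mulrA; congr (_ * _).
rewrite dot_suml; apply: eq_bigr => s _; rewrite dotZl dot_sumr mulr_sumr.
by apply: eq_bigr => s' _; rewrite dotZr mulrA.
Qed.

(** Cauchy-Schwarz over the H^2 pairs of lags gives (2p/H)^2 H^4 (n - H)^-4 times the bound of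
    [qform_var]. With [dirm4] and [dirm6] that bound is 9n/p^2 + 90n^2/p^3, whence 36 and 10. *)
Lemma cvar_var :
  \int[Q]_x ((cvar t x - vtime t) ^+ 2) <=
  36 * H%:R ^+ 2 * (n - H)%:R ^- 4 * (n%:R + 10 * n%:R ^+ 2 / p%:R).
Proof.
pose N h : R := \sum_(s < t) (h < s)%:R.
pose D (e : 'I_H * 'I_H) x : R := lagw e.1.+1 * lagw e.2.+1 *
  (qform t e.1.+1 e.2.+1 x - (e.1.+1 == e.2.+1)%:R / p%:R * N e.1.+1).
have bD e : bmf (D e : arrT -> R).
  by apply: bmfZ; apply: bmfB; [exact: bmf_qform|exact: bmf_cst].
have p0 : (p%:R : R) != 0 by rewrite pnatr_eq0 -lt0n.
have h0 : (H%:R : R) != 0 by rewrite pnatr_eq0 -lt0n.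
have E x : cvar t x - vtime t = 2 * p%:R / H%:R * \sum_e D e x.
  rewrite -(pair_bigA _ (fun h h' => D (h, h') x)) /=.
  rewrite /cvar dot_ivec /vtime.
  transitivity (2 * p%:R / H%:R *
    (\sum_(h < H) \sum_(h' < H) lagw h.+1 * lagw h'.+1 * qform t h.+1 h'.+1 x -
     \sum_(h < H) p%:R^-1 * (lagw h.+1 ^+ 2 * N h.+1))).
    by rewrite -mulr_sumr mulrBr; congr (_ - _); field; rewrite p0 h0.
  congr (_ * _); rewrite -sumrB; apply: eq_bigr => h _.
  rewrite (bigD1 h)//= [RHS](bigD1 h)//= /D /= eqxx addrAC; congr (_ + _).
    by rewrite mulr1n; field.
  apply: eq_bigr => h' h'h; rewrite eqSS (_ : (_ == _ :> nat) = false) ?mul0r ?subr0//.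
  by apply/negP => /eqP hh; move/eqP : h'h; apply; exact: val_inj.
set K : R := 3 * (t%:R * dirm mu 4 + 2 * (t%:R ^+ 2 * dirm mu 6)).
set W : R := (n - H)%:R^-1.
have W0 : 0 <= W by rewrite invr_ge0.
have w0 h : 0 <= lagw h by rewrite invr_ge0.
have wW (h : 'I_H) : lagw h.+1 <= W.
  have := ltn_ord h => hH.
  by rewrite lef_pV2 ?posrE ?ltr0n ?subn_gt0 ?ler_nat//; lia.
have DK e : \int[Q]_x (D e x ^+ 2) <= W ^+ 4 * K.
  rewrite (eq_Rintegral _ (g := fun x : arrT => (lagw e.1.+1 * lagw e.2.+1) ^+ 2 *
    (qform t e.1.+1 e.2.+1 x - (e.1.+1 == e.2.+1)%:R / p%:R * N e.1.+1) ^+ 2)); last first.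
    by move=> x _; rewrite exprMn.
  rewrite meanZ; last first.
    by apply: bmfX; apply: bmfB; [exact: bmf_qform|exact: bmf_cst].
  have tn' : (t <= n)%N by case/andP : tn.
  apply: ler_pM; [exact: sqr_ge0|by apply: mean_ge0 => x; exact: sqr_ge0| |].
    rewrite (exprM W 2 2); apply: ler_pM; rewrite ?mulr_ge0// expr2 ler_pM//.
  exact: (qform_var tn').
rewrite (eq_Rintegral _ (g := fun x : arrT => (2 * p%:R / H%:R) ^+ 2 * (\sum_e D e x) ^+ 2));
  last by move=> x _; rewrite E exprMn.
have bS : bmf (fun x : arrT => \sum_e D e x) by apply: bmf_sum.
have bS2 : bmf (fun x : arrT => \sum_e D e x ^+ 2) by apply: bmf_sum => e _; exact: bmfX.
rewrite meanZ; last exact: bmfX.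
have S1 : \int[Q]_x ((\sum_e D e x) ^+ 2) <= H%:R ^+ 2 * (H%:R ^+ 2 * (W ^+ 4 * K)).
  apply: (@le_trans _ _ (\int[Q]_x (H%:R ^+ 2 * \sum_e D e x ^+ 2))).
    apply: mean_le; [exact: bmfX|exact: bmfZ|move=> x].
    by apply: le_trans (sqr_sum_le _) _; rewrite card_prod card_ord natrM expr2.
  rewrite meanZ// ler_wpM2l ?exprn_ge0// mean_sum; last by move=> e _; exact: bmfX.
  apply: le_trans (ler_sum _ (fun e _ => DK e)) _.
  by rewrite sumr_const card_prod card_ord -[_ *+ _]mulr_natl natrM expr2.
apply: le_trans (ler_wpM2l (sqr_ge0 _) S1) _.
have Kle : K <= 3 * (n%:R * (3 / p%:R ^+ 2) + 2 * (n%:R ^+ 2 * (15 / p%:R ^+ 3))).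
  have tn' : (t%:R : R) <= n%:R by rewrite ler_nat; case/andP : tn.
  have d4 := dirm4 p_gt0 mu0 mu_rot; have d6 := dirm6 p_gt0 mu0 mu_rot.
  have d40 : 0 <= dirm mu 4 by apply: mean_ge0 => v; rewrite exprn_even_ge0.
  have d60 : 0 <= dirm mu 6 by apply: mean_ge0 => v; rewrite exprn_even_ge0.
  rewrite /K ler_pM2l//; apply: lerD; first exact: ler_pM.
  by rewrite ler_pM2l//; apply: ler_pM => //; rewrite lerXn2r// nnegrE.
have W40 : 0 <= W ^+ 4 by rewrite exprn_ge0.
have := ler_wpM2l W40 Kle => WK.
have := ler_wpM2l (exprn_ge0 2 (ler0n R H)) WK => {}WK.
have := ler_wpM2l (exprn_ge0 2 (ler0n R H)) WK => {}WK.
have := ler_wpM2l (sqr_ge0 (2 * p%:R / H%:R)) WK => {}WK.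
apply: le_trans WK _; rewrite /W -exprVn le_eqVlt; apply/orP; left; apply/eqP.
by field; rewrite p0 h0 pnatr_eq0 subn_eq0 -ltnNge H_lt_n.
Qed.

End one_step.

Let W : R := (n - H)%:R^-1.

Let W_gt0 : 0 < W.
Proof. by rewrite invr_gt0 ltr0n subn_gt0. Qed.

Let lagw_ge0 h : 0 <= lagw h.
Proof. by rewrite invr_ge0. Qed.

Let lagw_le (h : 'I_H) : lagw h.+1 <= W.
Proof.
have := ltn_ord h => hH.
by rewrite lef_pV2 ?posrE ?ltr0n ?subn_gt0 ?ler_nat//; lia.
Qed.

Lemma vtime_ge0 t : 0 <= vtime t.
Proof.
rewrite mulr_ge0 ?divr_ge0// sumr_ge0// => h _.
by rewrite mulr_ge0 ?sqr_ge0// sumr_ge0.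
Qed.

Lemma vtime_le t : (t <= n)%N -> vtime t <= 2 * W ^+ 2 * n%:R.
Proof.
move=> tn; have H0 : (0 : R) < H%:R by rewrite ltr0n.
apply: (@le_trans _ _ (2 / H%:R * \sum_(h < H) W ^+ 2 * n%:R)).
  rewrite ler_wpM2l ?divr_ge0//; apply: ler_sum => h _.
  apply: ler_pM; rewrite ?sqr_ge0 ?sumr_ge0//.
    by apply: lerXn2r; rewrite ?nnegrE// ltW.
  by rewrite -natr_sum ler_nat sum_lt_ord; lia.
rewrite sumr_const card_ord -[_ *+ H]mulr_natl le_eqVlt; apply/orP; left; apply/eqP.
by field; rewrite gt_eqF.
Qed.

(** With m = n - h, lag h contributes 2 m^-2 times m (m - 1) / 2, that is 1 - 1/m, and the lags are
    averaged. *)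
Lemma sum_vtime : 1 - W <= \sum_(i < n) vtime i.+1 <= 1.
Proof.
have H0 : (0 : R) < H%:R by rewrite ltr0n.
have -> : \sum_(i < n) vtime i.+1 = H%:R^-1 * \sum_(h < H) (1 - lagw h.+1).
  rewrite /vtime -mulr_sumr exchange_big /= (mulrC 2) -mulrA; congr (_ * _).
  rewrite mulr_sumr; apply: eq_bigr => h _.
  have := ltn_ord h => hH.
  rewrite -mulr_sumr mulrCA.
  have -> : 2 * \sum_(i < n) \sum_(s < i.+1) (h.+1 < s)%:R =
      (n - h.+1)%:R * ((n - h.+1)%:R - 1) :> R.
    under eq_bigr do rewrite -natr_sum.
    rewrite -natr_sum -natrM sum_sum_lt_ord natrM; congr (_ * _).
    by rewrite -subn1 natrB// subn_gt0; lia.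
  have : (n - h.+1)%:R != 0 :> R by rewrite pnatr_eq0 subn_eq0 -ltnNge; lia.
  by rewrite /lagw => nh; field.
have card : \sum_(h < H) (1 : R) = H%:R by rewrite sumr_const card_ord.
apply/andP; split.
  rewrite -[leLHS](@mulKf _ H%:R) ?gt_eqF// ler_pM2l ?invr_gt0//.
  rewrite -card mulr_suml; apply: ler_sum => h _.
  by rewrite mul1r lerB.
rewrite -[leRHS](@mulVf _ H%:R) ?gt_eqF// ler_pM2l ?invr_gt0//.
by rewrite -card; apply: ler_sum => h _; rewrite gerBl.
Qed.

Definition psum k x : R := \sum_(i < k) incr i.+1 x.

Lemma bmf_psum k : bmf (psum k : arrT -> R).
Proof. by apply: bmf_sum => i _; exact: bmf_incr. Qed.

Lemma free_psum k : (k < n)%N -> free k.+1 (psum k).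
Proof.
move=> kn x z; apply: eq_bigr => i _; have := ltn_ord i => ik.
by rewrite free_incr//; lia.
Qed.

(** The square root of the bound in [cvar_var]. For fixed H, n times it is of order sqrt(1/n +
    10/p). *)
Definition dev : R :=
  6 * H%:R * W ^+ 2 * Num.sqrt (n%:R + 10 * n%:R ^+ 2 / p%:R).

Lemma dev_ge0 : 0 <= dev.
Proof. by rewrite !mulr_ge0// ltW. Qed.

Lemma dev_sqr : dev ^+ 2 = 36 * H%:R ^+ 2 * (n - H)%:R ^- 4 * (n%:R + 10 * n%:R ^+ 2 / p%:R).
Proof.
rewrite /dev 3!exprMn sqr_sqrtr; last by rewrite addr_ge0// divr_ge0// mulr_ge0// sqr_ge0.
by rewrite -exprM -/W -exprVn; congr (_ * _ * _ * _); rewrite -natrX.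
Qed.

Section step.
Variable t : nat.
Hypothesis tn : (1 <= t <= n)%N.

Let bincr := bmf_incr t.
Let bcvar := bmf_cvar t.

Let bdiff : bmf (fun x : arrT => cvar t x - vtime t).
Proof. by apply: bmfB => //; exact: bmf_cst. Qed.

Lemma mean_cvar_dev : \int[Q]_x `|cvar t x - vtime t| <= dev.
Proof.
apply: le_trans (mean_norm_le_sqrt Q bdiff) _.
rewrite -[leRHS]ger0_norm ?dev_ge0// -sqrtr_sqr ler_wsqrtr// dev_sqr.
exact: (cvar_var tn).
Qed.

Lemma mean_cvar_le : \int[Q]_x cvar t x <= dev + vtime t.
Proof.
apply: (@le_trans _ _ (\int[Q]_x (`|cvar t x - vtime t| + vtime t))).
  apply: mean_le => //; first by apply: bmfD; [exact: bmf_norm|exact: bmf_cst].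
  by move=> x; rewrite -lerBlDr ler_norm.
rewrite meanD; [|exact: bmf_norm|exact: bmf_cst].
by rewrite mean_cst lerD2r mean_cvar_dev.
Qed.

Lemma mean_cvar_sqr_le : \int[Q]_x (cvar t x ^+ 2) <= 2 * (dev ^+ 2 + vtime t ^+ 2).
Proof.
have b2 := bmfX 2 bdiff; have bc := bmf_cst arrT (vtime t ^+ 2).
apply: (@le_trans _ _ (\int[Q]_x (2 * ((cvar t x - vtime t) ^+ 2 + vtime t ^+ 2)))).
  apply: mean_le; [exact: bmfX|by apply: bmfZ; exact: bmfD|].
  move=> x; move: (cvar t x) (vtime t) => a b.
  have : 0 <= (a - b - b) ^+ 2 by exact: sqr_ge0.
  by rewrite (_ : (a - b - b) ^+ 2 = 2 * ((a - b) ^+ 2 + b ^+ 2) - a ^+ 2);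
    [lra|ring].
rewrite meanZ; last exact: bmfD.
rewrite meanD// mean_cst ler_pM2l// lerD2r dev_sqr.
exact: (cvar_var tn).
Qed.

(** Summed over t, the first part stays of order eta since the total variance is about 1, while the
    second tends to 0 for fixed eta. *)
Lemma mean_incr3 (eta : R) : 0 < eta -> \int[Q]_x (`|incr t x| ^+ 3) <=
  eta / 2 * (dev + vtime t) + 3 / eta * (dev ^+ 2 + vtime t ^+ 2).
Proof.
move=> eta0.
have bi2 := bmfX 2 (bmf_incr t); have bi4 := bmfX 4 (bmf_incr t).
have bA := bmfZ (eta / 2) bi2; have bB := bmfZ (2 * eta)^-1 bi4.
apply: (@le_trans _ _ (\int[Q]_x (eta / 2 * incr t x ^+ 2 + (2 * eta)^-1 * incr t x ^+ 4))).
  apply: mean_le; [exact/bmfX/bmf_norm|exact: bmfD|].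
  move=> x; rewrite -[incr t x ^+ 2]real_normK ?num_real//.
  rewrite (exprM _ 2 2) -[incr t x ^+ 2]real_normK ?num_real// -exprM.
  move: `|incr t x| => y.
  (* AM-GM: [y ^ 3 <= eta / 2 * y ^ 2 + y ^ 4 / (2 * eta)]. *)
  have : 0 <= (2 * eta)^-1 * (y * (eta - y)) ^+ 2.
    by rewrite mulr_ge0 ?sqr_ge0// invr_ge0 mulr_ge0// ltW.
  rewrite (_ : _ * _ ^+ 2 = eta / 2 * y ^+ 2 + (2 * eta)^-1 * y ^+ (2 * 2) - y ^+ 3); last first.
    by field; rewrite gt_eqF.
  by rewrite subr_ge0.
rewrite (meanD _ bA bB) (meanZ _ _ bi2) (meanZ _ _ bi4).
apply: lerD.
  rewrite ler_pM2l ?divr_gt0//.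
  have e := mean_incr_sqr tn (bmf_cst arrT (1 : R))
    (fun _ _ => erefl).
  suff -> : \int[Q]_x (incr t x ^+ 2) = \int[Q]_x cvar t x by exact: mean_cvar_le.
  transitivity (\int[Q]_x (1 * incr t x ^+ 2)).
    by apply: eq_Rintegral => x _; rewrite mul1r.
  by rewrite e; apply: eq_Rintegral => x _; rewrite mul1r.
apply: (@le_trans _ _ ((2 * eta)^-1 * (3 * (2 * (dev ^+ 2 + vtime t ^+ 2))))).
  rewrite ler_pM2l ?invr_gt0 ?mulr_gt0//.
  apply: le_trans (mean_incr4 tn) _.
  by rewrite ler_pM2l// mean_cvar_sqr_le.
by rewrite le_eqVlt; apply/orP; left; apply/eqP; field; rewrite gt_eqF.
Qed.

End step.
Section telescoping.
Variables (a s0 eta : R).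
Hypotheses (s0_gt0 : 0 < s0) (eta_gt0 : 0 < eta).

(** One constant dominating the bound on [heat2] and the remainder constants of the space and time
    expansions. *)
Definition hconst : R :=
  gbound R / s0 + 2 * gbound R / Num.sqrt s0 ^+ 3 + gbound R / s0 ^+ 2.

Lemma hconst_parts : [/\ 0 <= hconst, gbound R / s0 <= hconst,
  2 * gbound R / Num.sqrt s0 ^+ 3 <= hconst & gbound R / s0 ^+ 2 <= hconst].
Proof.
have g0 := gbound_ge0 R.
have A : 0 <= gbound R / s0 by apply: divr_ge0 => //; exact: ltW.
have B : 0 <= 2 * gbound R / Num.sqrt s0 ^+ 3.
  by apply: divr_ge0; [exact: mulr_ge0|exact: exprn_ge0].
have C : 0 <= gbound R / s0 ^+ 2 by apply: divr_ge0 => //; exact: sqr_ge0.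
by rewrite /hconst; split; lra.
Qed.

Lemma bmf_heat s F : measurable_fun setT F -> bmf (fun x : arrT => heat a s (F x)).
Proof.
move=> mF; apply: (bmf_comp (g := heat a s)) => //; first exact: measurable_heat.
by exists 1; exact: heat_bound.
Qed.

Lemma heat_step k s : (k < n)%N -> s0 <= s ->
  `|\int[Q]_x heat a s (psum k.+1 x) - \int[Q]_x heat a (s + vtime k.+1) (psum k x)| <=
  hconst * (dev + (eta / 2 * (dev + vtime k.+1) +
     3 / eta * (dev ^+ 2 + vtime k.+1 ^+ 2)) + vtime k.+1 ^+ 2).
Proof.
move=> kn s0s; set t := k.+1; set tau := vtime t.
have tn : (1 <= t <= n)%N by rewrite /t; lia.
have tau0 : 0 <= tau by exact: vtime_ge0.
have [C0 C1 C2 C3] := hconst_parts.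
have mS j : measurable_fun setT (psum j : arrT -> R) by have [] := bmf_psum j.
pose h1 x := heat1 a s (psum k x); pose h2 x := heat2 a s (psum k x).
have bh1 : bmf (h1 : arrT -> R).
  apply: (bmf_comp (g := heat1 a s)) => //; first exact: measurable_heat1.
  by exists (gbound R / Num.sqrt s); exact: heat1_bound.
have bh2 : bmf (h2 : arrT -> R).
  apply: (bmf_comp (g := heat2 a s)) => //; first exact: measurable_heat2.
  by exists (gbound R / s0) => y; exact: heat2_bound.
have fh1 : free t h1 by move=> x z; rewrite /h1 free_psum.
have fh2 : free t h2 by move=> x z; rewrite /h2 free_psum.
have bi := bmf_incr t; have bc := bmf_cvar t.
have bA := bmf_heat s (mS t); have bB := bmf_heat (s + tau) (mS k).
(* Both values are expanded around [heat a s (psum k x)], in space by the increment and in time by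
   [tau]. By the heat equation the second-order space term and the first-order time term share the
   factor [h2]; [r] collects the two remainders. *)
pose r x := heat a s (psum t x) - heat a (s + tau) (psum k x) -
  (h1 x * incr t x + 2^-1 * (h2 x * incr t x ^+ 2 - tau * h2 x)).
have b1 := bmfM bh1 bi; have b2 := bmfM bh2 (bmfX 2 bi); have b3 := bmfZ tau bh2.
have b23 := bmfZ 2^-1 (bmfB b2 b3); have bAB := bmfB bA bB; have b123 := bmfD b1 b23.
have br : bmf (r : arrT -> R) by exact: bmfB.
(* [h1] and [h2] depend on the past only, so the linear term integrates to 0 and the squared
   increment may be replaced by [cvar]. *)
have E : \int[Q]_x heat a s (psum t x) - \int[Q]_x heat a (s + tau) (psum k x) =
    \int[Q]_x r x + 2^-1 * \int[Q]_x (h2 x * (cvar t x - tau)).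
  rewrite /r (meanB Q bAB b123) (meanB Q bA bB) (meanD Q b1 b23) (meanZ Q _ (bmfB b2 b3)).
  rewrite (meanB Q b2 b3) (mean_incr tn bh1 fh1).
  rewrite (mean_incr_sqr tn bh2 fh2).
  have -> : \int[Q]_x (h2 x * (cvar t x - tau)) =
      \int[Q]_x (h2 x * cvar t x) - \int[Q]_x (tau * h2 x).
    rewrite -(meanB Q (bmfM bh2 bc) b3).
    by apply: eq_Rintegral => x _; ring.
  by rewrite add0r subrK.
rewrite E; apply: (le_trans (ler_normD _ _)).
have r_le : `|\int[Q]_x r x| <= hconst * (eta / 2 * (dev + tau) +
     3 / eta * (dev ^+ 2 + tau ^+ 2) + tau ^+ 2).
  apply: (le_trans (mean_norm Q br)).
  have b3n := bmfX 3 (bmf_norm bi).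
  have bK := bmf_cst arrT (tau ^+ 2).
  apply: (@le_trans _ _ (\int[Q]_x (hconst * (`|incr t x| ^+ 3 + tau ^+ 2)))).
    apply: mean_le; [exact: bmf_norm|by apply: bmfZ; exact: bmfD|move=> x].
    have := heat_space_step a (psum k x) (incr t x) s0_gt0 s0s.
    have := heat_time_step a (psum k x) s0_gt0 s0s tau0.
    have St : psum t x = psum k x + incr t x by rewrite /psum big_ord_recr.
    rewrite /r St -/(h1 x) -/(h2 x).
    set A1 := heat a (s + tau) _; set A2 := heat a s (psum k x).
    set A3 := heat a s (_ + _) => T1 T2.
    have -> : A3 - A1 - (h1 x * incr t x + 2^-1 * (h2 x * incr t x ^+ 2 - tau * h2 x)) =
      (A3 - A2 - incr t x * h1 x - incr t x ^+ 2 / 2 * h2 x) -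
      (A1 - A2 - tau * (h2 x / 2)) by field.
    apply: (le_trans (ler_normB _ _)); rewrite mulrDr; apply: lerD.
      by apply: (le_trans T2); rewrite ler_wpM2r// exprn_ge0.
    by apply: (le_trans T1); rewrite ler_wpM2r// sqr_ge0.
  rewrite (meanZ Q _ (bmfD b3n bK)) (meanD Q b3n bK) mean_cst ler_wpM2l// lerD2r.
  exact: mean_incr3.
have d_le : `|2^-1 * \int[Q]_x (h2 x * (cvar t x - tau))| <= hconst * dev.
  have bd := bmfB bc (bmf_cst arrT tau).
  have bhd := bmfM bh2 bd.
  have nd := bmf_norm bd.
  rewrite normrM ger0_norm ?invr_ge0//.
  apply: (@le_trans _ _ `|\int[Q]_x (h2 x * (cvar t x - tau))|).
    by rewrite ler_piMl// invf_le1// ler1n.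
  apply: (le_trans (mean_norm Q bhd)).
  apply: (@le_trans _ _ (\int[Q]_x (hconst * `|cvar t x - tau|))).
    apply: mean_le; [exact: bmf_norm|exact: bmfZ|move=> x].
    rewrite normrM ler_wpM2r// (le_trans _ C1)//; exact: heat2_bound.
  by rewrite (meanZ Q _ nd) ler_wpM2l// mean_cvar_dev.
apply: (le_trans (lerD r_le d_le)).
by rewrite -mulrDr [X in _ * X <= _]addrC [X in _ * X <= _]addrA.
Qed.

Definition dtot : R := n%:R * dev.
(** It bounds every [vtime], and also the sum of their squares since they sum to at most 1. *)
Definition tmax : R := 2 * W ^+ 2 * n%:R.

Lemma heat_telescope :
  `|\int[Q]_x heat a s0 (psum n x) - gcdf (a / Num.sqrt (s0 + \sum_(i < n) vtime i.+1))| <=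
  hconst * (dtot + (eta / 2 * (dtot + 1) + 3 / eta * (dtot ^+ 2 + tmax)) + tmax).
Proof.
have [C0 _ _ _] := hconst_parts.
have n0 : (0 < n)%N by exact: leq_ltn_trans H_lt_n.
have /andP[_ tau1] := sum_vtime.
(* [st k] is s0 plus the variance still to come after k rows. At k = n the integrand is the smoothed
   indicator; at k = 0 the partial sum is 0 and the integrand is constant. *)
pose st k : R := s0 + \sum_(k <= i < n) vtime i.+1.
pose A k := \int[Q]_x heat a (st k) (psum k x).
have st_ge k : s0 <= st k.
  by rewrite lerDl sumr_ge0// => i _; exact: vtime_ge0.
have An : \int[Q]_x heat a s0 (psum n x) = A n.
  have e : st n = s0 by rewrite /st big_geq ?addr0.
  exact: (congr1 (fun r => \int[Q]_x heat a r (psum n x)) (esym e)).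
have A0 : gcdf (a / Num.sqrt (s0 + \sum_(i < n) vtime i.+1)) = A 0%N.
  rewrite /A -[LHS](mean_cst Q); apply: eq_Rintegral => x _.
  by rewrite /heat /psum big_ord0 subr0 /st big_mkord.
rewrite An A0 -(telescope_sumr A (leq0n n)) big_mkord {An A0}.
apply: (le_trans (ler_norm_sum _ _ _)).
pose B (i : nat) : R := hconst * (dev + (eta / 2 * (dev + vtime i.+1) +
     3 / eta * (dev ^+ 2 + vtime i.+1 ^+ 2)) + vtime i.+1 ^+ 2).
apply: (@le_trans _ _ (\sum_(i < n) B i)).
  apply: ler_sum => i _; have := ltn_ord i => ilt.
  have -> : A i = \int[Q]_x heat a (st i.+1 + vtime i.+1) (psum i x).
    have e : st i = st i.+1 + vtime i.+1 by rewrite /st (big_ltn ilt) addrCA [RHS]addrC.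
    exact: (congr1 (fun r => \int[Q]_x heat a r (psum i x)) e).
  exact: heat_step.
have sq : \sum_(i < n) vtime i.+1 ^+ 2 <= tmax.
  apply: (@le_trans _ _ (\sum_(i < n) tmax * vtime i.+1)).
    apply: ler_sum => i _; rewrite expr2 ler_wpM2r ?vtime_ge0//.
    by apply: vtime_le; exact: ltn_ord.
  rewrite -mulr_sumr ler_piMr// /tmax; apply: mulr_ge0 => //.
  by apply: mulr_ge0 => //; exact: sqr_ge0.
have gen (D : R) (v : nat -> R) : \sum_(i < n) (D + (eta / 2 * (D + v i) +
     3 / eta * (D ^+ 2 + v i ^+ 2)) + v i ^+ 2) =
   n%:R * D + (eta / 2 * (n%:R * D + \sum_(i < n) v i) +
   3 / eta * (n%:R * D ^+ 2 + \sum_(i < n) v i ^+ 2)) + \sum_(i < n) v i ^+ 2.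
  have cst (c : R) : \sum_(i < n) c = n%:R * c by rewrite sumr_const card_ord mulr_natl.
  by rewrite !(big_split, =^~ mulr_sumr) /= !cst; ring.
rewrite /B -mulr_sumr (gen dev (fun i => vtime i.+1)) -/dtot.
rewrite ler_wpM2l// lerD// lerD2l lerD//.
  by rewrite ler_pM2l ?divr_gt0// lerD2l.
(* As n >= 1, n dev^2 <= (n dev)^2. *)
rewrite ler_pM2l ?divr_gt0// lerD// /dtot [leRHS]exprMn ler_wpM2r ?sqr_ge0//.
by rewrite expr2 ler_peMl// ler1n.
Qed.

End telescoping.

(** The errors are, in order, the telescoping, the shift of the threshold by [zeta], the total time
    differing from 1 by at most s0 + W, and the tails of the smoothed indicator at distance [zeta]
    from its centre. *)
Lemma cdf_bound (y zeta s0 eta : R) : 0 < zeta -> 0 < s0 -> 0 < eta -> W <= 2^-1 ->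
  `|fine (Q [set x : arrT | psum n x <= y]) - gcdf y| <=
  hconst s0 * (dtot + (eta / 2 * (dtot + 1) +
    3 / eta * (dtot ^+ 2 + tmax)) + tmax) +
  gbound R * zeta + 2 * gbound R * (`|y| + zeta) * (s0 + W) +
  ((1 - gcdf (zeta / Num.sqrt s0)) + gcdf (- (zeta / Num.sqrt s0))).
Proof.
move=> zeta0 s00 eta0 W2.
set err := hconst s0 * _.
have mS : measurable_fun setT (psum n : arrT -> R).
  by have [] := bmf_psum n.
set A := [set x : arrT | psum n x <= y].
have mA : measurable A by exact: measurable_le_set.
have bA := bmf_indic R mA.
have bh a := bmf_heat a s0 mS.
have q0 : 0 < Num.sqrt s0 by rewrite sqrtr_gt0.
have W0 : 0 < W by rewrite invr_gt0 ltr0n subn_gt0.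
have /andP[V1 V2] := sum_vtime.
set V := \sum_(i < n) _ in V1 V2.
have g0 := gbound_ge0 R.
have gap a : `|gcdf (a / Num.sqrt (s0 + V)) - gcdf y| <=
    gbound R * `|a - y| + 2 * gbound R * `|a| * (s0 + W).
  rewrite (_ : _ - _ = (gcdf (a / Num.sqrt (s0 + V)) - gcdf a) + (gcdf a - gcdf y)); last by ring.
  apply: (le_trans (ler_normD _ _)); rewrite addrC lerD ?gcdf_lipschitz//.
  apply: (le_trans (gcdf_lipschitz _ _)).
  rewrite [X in `|X|](_ : _ = a * ((Num.sqrt (s0 + V))^-1 - 1)); last by ring.
  rewrite normrM [leRHS](_ : _ = gbound R * (`|a| * (2 * (s0 + W)))); last by ring.
  rewrite ler_wpM2l// ler_wpM2l//.
  have sV : 2^-1 <= s0 + V by move: V1; rewrite -/W; lra.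
  apply: (le_trans (invsqrt_dist sV)); rewrite ler_pM2l// ler_norml.
  by apply/andP; split; move: V1; rewrite -/W; lra.
have tel a := heat_telescope a s00 eta0.
have est a : `|a - y| <= zeta -> `|a| <= `|y| + zeta ->
    `|\int[Q]_x heat a s0 (psum n x) - gcdf y| <=
    err + (gbound R * zeta + 2 * gbound R * (`|y| + zeta) * (s0 + W)).
  move=> a1 a2.
  rewrite (_ : _ - _ = (\int[Q]_x heat a s0 (psum n x) - gcdf (a / Num.sqrt (s0 + V))) +
    (gcdf (a / Num.sqrt (s0 + V)) - gcdf y)); last by rewrite addrA subrK.
  apply: (le_trans (ler_normD _ _)); apply: lerD; first exact: tel.
  apply: (le_trans (gap a)); apply: lerD; first by rewrite ler_wpM2l.
  by rewrite ler_wpM2r ?addr_ge0 ?(ltW s00) ?(ltW W0)// ler_wpM2l// mulr_ge0.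
rewrite -(mean_indic Q mA).
set tu := gcdf (zeta / Num.sqrt s0); set td := gcdf (- (zeta / Num.sqrt s0)).
have tu1 : tu <= 1 by exact: gcdf_le1.
have td0 : 0 <= td by exact: gcdf_ge0.
(* The indicator of psum <= y is squeezed between smoothed indicators centred at y - zeta and y +
   zeta, up to the tails [td] and 1 - [tu]. *)
have upper : \int[Q]_x \1_A x <= \int[Q]_x heat (y + zeta) s0 (psum n x) + (1 - tu).
  rewrite -[X in _ <= _ + X](mean_cst Q) -(meanD Q (bh _) (bmf_cst _ _)).
  apply: mean_le => //; first by apply: bmfD; [exact: bh|exact: bmf_cst].
  move=> x; rewrite indicE; have [xA|xA] := boolP (x \in A) => /=.
    have : tu <= heat (y + zeta) s0 (psum n x).
      move: xA; rewrite inE /A /= => xA; apply: gcdf_nondecreasing.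
      by rewrite ler_wpM2r ?invr_ge0//; lra.
    rewrite mulr1n; lra.
  have : 0 <= heat (y + zeta) s0 (psum n x) by exact: gcdf_ge0.
  rewrite mulr0n; lra.
have lower : \int[Q]_x heat (y - zeta) s0 (psum n x) <= \int[Q]_x \1_A x + td.
  rewrite -[X in _ <= _ + X](mean_cst Q) -(meanD Q bA (bmf_cst _ _)).
  apply: mean_le => //; first by apply: bmfD => //; exact: bmf_cst.
  move=> x; rewrite indicE; have [xA|xA] := boolP (x \in A) => /=.
    have : heat (y - zeta) s0 (psum n x) <= 1 by exact: gcdf_le1.
    rewrite mulr1n; lra.
  rewrite mulr0n add0r.
  move/negP: xA; rewrite inE /A /= => /negP; rewrite -ltNge => xA.
  by apply: gcdf_nondecreasing; rewrite -mulNr ler_wpM2r ?invr_ge0//; lra.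
have := est (y + zeta); have := est (y - zeta).
rewrite (_ : y - zeta - y = - zeta); last by ring.
rewrite (_ : y + zeta - y = zeta); last by ring.
rewrite normrN (gtr0_norm zeta0) lexx.
have n1 : `|y - zeta| <= `|y| + zeta
  by apply: (le_trans (ler_normB _ _)); rewrite (gtr0_norm zeta0).
have n2 : `|y + zeta| <= `|y| + zeta
  by apply: (le_trans (ler_normD _ _)); rewrite (gtr0_norm zeta0).
move=> /(_ isT n1) E1 /(_ isT n2) E2.
move: upper lower E1 E2; clear - tu1 td0.
move: (\int[Q]_x \1_A x) (\int[Q]_x heat (y + zeta) s0 (psum n x))
  (\int[Q]_x heat (y - zeta) s0 (psum n x)) => I J K.
move: (gcdf y) err (gbound R * zeta) (2 * gbound R * (`|y| + zeta) * (s0 + W)) => g e b c.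
rewrite !ler_norml => U L /andP[E1 E2] /andP[E3 E4].
by apply/andP; split; lra.
Qed.

End lags.
End array.

(** * The statistic and its law *)

Lemma frob_sqr (R : realType) (p : nat) (A : 'M[R]_p) : frob A ^+ 2 = \tr (A *m A^T).
Proof.
rewrite /frob sqr_sqrtr//; apply: sumr_ge0 => i _; rewrite mxE.
by apply: sumr_ge0 => j _; rewrite mxE -expr2 sqr_ge0.
Qed.

Lemma mxtrace_outer (R : realType) (p : nat) (u v u' v' : 'cV[R]_p) :
  \tr ((u *m v^T) *m (u' *m v'^T)^T) = dot v v' * dot u u'.
Proof.
rewrite trmx_mul trmxK mulmxA -(mulmxA u) (_ : v^T *m v' = (dot v v')%:M); last first.
  by apply/matrixP => i j; rewrite !ord1 dotE mxE eqxx.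
rewrite mul_mx_scalar -scalemxAl mxtraceZ mxtrace_mulC trace_mx11 dotE.
by rewrite (dotC u').
Qed.

Lemma sum_nat_sym (R : comRingType) (a : nat -> nat -> R) m n :
  (forall s t, a s t = a t s) ->
  \sum_(m <= t < n) \sum_(m <= s < n) a t s =
  \sum_(m <= t < n) a t t + 2 * \sum_(m <= t < n) \sum_(m <= s < t) a t s.
Proof.
move=> sym; have [mn|nm] := leqP m n; last first.
  by rewrite !(big_geq (ltnW nm)) mulr0 addr0.
rewrite -(subnKC mn); elim: (n - m)%N => [|k IH].
  by rewrite addn0 !big_geq// mulr0 addr0.
have mk : (m <= m + k)%N by rewrite leq_addr.
rewrite addnS !big_nat_recr//=.
rewrite (eq_bigr (fun t => \sum_(m <= s < m + k) a t s + a t (m + k)%N)); last first.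
  by move=> t _; rewrite big_nat_recr.
rewrite big_split /= IH (eq_bigr (fun s => a (m + k)%N s)); last by move=> s _; rewrite sym.
ring.
Qed.

Section statistic.
Context (R : realType) (p n H : nat).
Hypotheses (p_gt0 : (0 < p)%N) (H_gt0 : (0 < H)%N) (H_lt_n : (H < n)%N).

Lemma frob_rmat h (U : nat -> 'cV[R]_p) : frob (rmat n h U) ^+ 2 =
  (p%:R / (n - h)%:R) ^+ 2 * \sum_(h.+1 <= t < n.+1) \sum_(h.+1 <= s < n.+1)
    (dot (U (t - h)%N) (U (s - h)%N) * dot (U t) (U s)).
Proof.
rewrite frob_sqr /rmat linearZ /= -scalemxAl -scalemxAr !mxtraceZ mulrA -expr2.
congr (_ * _); rewrite linear_sum /= mulmx_suml raddf_sum /=.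
apply: eq_bigr => t _; rewrite mulmx_sumr raddf_sum /=.
by apply: eq_bigr => s _; rewrite mxtrace_outer.
Qed.

(** For unit vectors the diagonal s = t contributes p^2 per lag, exactly the centring; the two
    symmetric halves give the factor 2. *)
Lemma TStat_altE (U : nat -> 'cV[R]_p) :
  (forall t, (1 <= t <= n)%N -> dot (U t) (U t) = 1) ->
  TStat H n U = TStat_alt H n U.
Proof.
move=> U1; rewrite /TStat /TStat_alt /Tstat.
pose D h := \sum_(h.+1 <= t < n.+1) \sum_(h.+1 <= s < t)
  (dot (U (s - h)%N) (U (t - h)%N) * dot (U s) (U t)).
have pN : (p%:R : R) != 0 by rewrite pnatr_eq0 -lt0n.
have e1 h : (1 <= h < H.+1)%N -> (n - h)%:R * frob (rmat n h U) ^+ 2 =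
    p%:R ^+ 2 + 2 * p%:R ^+ 2 * ((n - h)%:R^-1 * D h).
  move=> /andP[h1 hH]; rewrite frob_rmat sum_nat_sym; last first.
    by move=> s t; rewrite dotC (dotC (U s)).
  have nN : ((n - h)%:R : R) != 0 by rewrite pnatr_eq0 subn_eq0 -ltnNge; lia.
  rewrite (_ : \sum_(_ <= t < _) (_ * dot (U t) (U t)) = (n - h)%:R); last first.
    rewrite (eq_big_nat _ _ (F2 := fun=> 1)); last first.
      by move=> t /andP[t1 t2]; rewrite !U1 ?mulr1//; lia.
    by rewrite sumr_const_nat subSS.
  rewrite (_ : \sum_(_ <= t < _) _ = D h); last first.
    by apply: eq_bigr => t _; apply: eq_bigr => s _; rewrite dotC (dotC (U t)).
  by field.
rewrite (eq_big_nat _ _ e1) big_split /= sumr_const_nat subSS subn0 -mulr_sumr.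
rewrite -[_ *+ H]mulr_natl addrAC subrr add0r.
rewrite [RHS](_ : _ = Num.sqrt (2 * p%:R ^+ 2) / Num.sqrt H%:R *
   \sum_(1 <= h < H.+1) (n - h)%:R^-1 * D h); last first.
  congr (_ * _); apply: eq_bigr => h _; congr (_ * _).
  by apply: eq_bigr => t _; apply: eq_bigr => s _; rewrite !dotE.
rewrite mulrAC; congr (_ * _).
have H0 : (0 : R) < Num.sqrt H%:R by rewrite sqrtr_gt0 ltr0n.
have p20 : (0 : R) < 2 * p%:R ^+ 2 by rewrite mulr_gt0// exprn_gt0// ltr0n.
rewrite [X in Num.sqrt X](_ : _ = 2 * p%:R ^+ 2 * H%:R); last by ring.
rewrite sqrtrM ?(ltW p20)//; set c := Num.sqrt (2 * _).
have c0 : 0 < c by rewrite sqrtr_gt0.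
have -> : 2 * p%:R ^+ 2 = c ^+ 2 by rewrite sqr_sqrtr// ltW.
by field; rewrite !gt_eqF.
Qed.

(** The sum is regrouped by the later row t instead of by lag. Lag h.+1 requires s >= h.+2, so both
    sides are empty for t <= h.+1. *)
Lemma psumE x : psum n H n x = TStat_alt H n (fun t => @sdir R p n t x).
Proof.
rewrite /psum /incr /TStat_alt -mulr_sumr; congr (_ * _).
rewrite big_add1 big_mkord /=.
rewrite (eq_bigr (fun i : 'I_n => \sum_(h < H) lagw R n h.+1 *
   \sum_(s < i.+1) @lagc R p n i.+1 h.+1 s x * gram n x i.+1 s)); last first.
  move=> i _; rewrite /ivec dot_sumr; apply: eq_bigr => h _; rewrite dotZr; congr (_ * _).
  by rewrite dot_sumr; apply: eq_bigr => s _; rewrite dotZr.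
rewrite exchange_big /=; apply: eq_bigr => h _; rewrite -mulr_sumr; congr (_ * _).
pose f t := \sum_(h.+2 <= s < t) gram n x (s - h.+1) (t - h.+1) * gram n x s t.
transitivity (\sum_(1 <= t < n.+1) f t).
  rewrite big_add1 big_mkord /=; apply: eq_bigr => i _; rewrite /f.
  rewrite (big_nat_widenl _ 0%N)// big_mkcond big_mkord /=.
  by apply: eq_bigr => s _; rewrite /lagc; case: ifP => _; rewrite ?mul0r// (gramC n x i.+1).
rewrite (big_nat_widenl h.+2 1%N)// [RHS]big_mkcond /=; apply: eq_bigr => t _.
case: ltnP => ht; first by apply: eq_bigr => s _; rewrite !dotE.
by rewrite /f big_geq//; lia.
Qed.

End statistic.

(** * Choice of the parameters and convergence of the distribution functions *)

Lemma remainder_small (R : realType) (H : nat) (kappa : R) : 0 < kappa ->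
  exists N : nat, forall n p : nat, (N <= n)%N -> (N <= p)%N ->
  [/\ (H < n)%N, (n - H)%:R^-1 <= kappa, (n - H)%:R^-1 <= 2^-1 :> R,
      dtot R p n H <= kappa & tmax R n H <= kappa].
Proof.
(* For n, p >= N >= 2H + 4 one has (n - H)^-1 <= 2/n and n + 10n^2/p <= 11n^2/N. Hence [dtot] is at
   most 24 H sqrt(11/N), the source of the first summand, and [tmax] at most 8/n, the source of the
   second. *)
move=> k0; pose x : R := 11 * (24 * H%:R) ^+ 2 / kappa ^+ 2 + 8 / kappa.
have A0 : 0 <= 11 * (24 * H%:R) ^+ 2 / kappa ^+ 2.
  by rewrite divr_ge0 ?exprn_ge0 ?(ltW k0)// mulr_ge0// sqr_ge0.
have B0 : 0 <= 8 / kappa by rewrite divr_ge0// ltW.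
exists (Num.bound x + (2 * H + 4))%N => n p Nn Np.
set N := (Num.bound x + (2 * H + 4))%N in Nn Np.
have xN : x < N%:R.
  apply: lt_le_trans (archi_boundP _) _; first exact: addr_ge0.
  by rewrite ler_nat /N leq_addr.
have N0 : (0 < N)%N by rewrite /N; lia.
have NR : (0 : R) < N%:R by rewrite ltr0n.
have n0 : (0 : R) < n%:R by rewrite ltr0n; lia.
have p0 : (0 : R) < p%:R by rewrite ltr0n; lia.
have Hn : (H < n)%N by move: Nn; rewrite /N; lia.
have n4 : (4 <= n)%N by move: Nn; rewrite /N; lia.
have m0 : (0 : R) < (n - H)%:R by rewrite ltr0n subn_gt0.
have NnR : (N%:R : R) <= n%:R by rewrite ler_nat.
have NpR : (N%:R : R) <= p%:R by rewrite ler_nat.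
have W_le : (n - H)%:R^-1 <= 2 / n%:R :> R.
  rewrite -div1r ler_pdivrMr// mulrAC ler_pdivlMr// mul1r -natrM ler_nat.
  by move: Nn; rewrite /N; lia.
have W0 : 0 <= (n - H)%:R^-1 :> R by rewrite invr_ge0.
have n8 : 8 / n%:R <= kappa.
  rewrite ler_pdivrMr// [leRHS]mulrC -ler_pdivrMr//.
  by apply: le_trans NnR; apply: le_trans (ltW xN); rewrite lerDr.
split => //.
- by apply: (le_trans W_le); apply: le_trans n8; rewrite ler_wpM2r ?invr_ge0 ?(ltW n0)// ler_nat.
- have n4R : 4 <= n%:R :> R by rewrite ler_nat.
  apply: (le_trans W_le); rewrite ler_pdivrMr//; move: n4R; clear; lra.
- rewrite /dtot /dev.
  apply: (@le_trans _ _ (n%:R * (6 * H%:R * (2 / n%:R) ^+ 2 * (n%:R * Num.sqrt (11 / N%:R))))).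
    rewrite ler_wpM2l//; apply: ler_pM => //.
    + by rewrite ler_wpM2l ?mulr_ge0//; apply: lerXn2r; rewrite ?nnegrE// divr_ge0// ltW.
    + rewrite -[X in X * Num.sqrt _](ger0_norm (ltW n0)) -sqrtr_sqr -sqrtrM ?sqr_ge0// ler_wsqrtr//.
      rewrite [leRHS](_ : _ = n%:R * n%:R / N%:R + 10 * n%:R ^+ 2 / N%:R); last by ring.
      apply: lerD.
        by rewrite -mulrA ler_peMr ?(ltW n0)// ler_pdivlMr// mul1r.
      by rewrite ler_wpM2l ?mulr_ge0 ?exprn_ge0 ?(ltW n0)// lef_pV2.
  rewrite [leLHS](_ : _ = 24 * H%:R * Num.sqrt (11 / N%:R)); last by field; rewrite gt_eqF.
  rewrite -ler_sqr ?nnegrE ?(ltW k0) ?mulr_ge0//.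
  rewrite exprMn sqr_sqrtr ?divr_ge0 ?(ltW NR)//.
  rewrite [leLHS](_ : _ = 11 * (24 * H%:R) ^+ 2 / N%:R); last by field; rewrite gt_eqF.
  rewrite ler_pdivrMr// [leRHS]mulrC -ler_pdivrMr ?exprn_gt0//.
  by apply: le_trans (ltW xN); rewrite lerDl.
- rewrite /tmax; apply: le_trans n8.
  apply: (@le_trans _ _ (2 * (2 / n%:R) ^+ 2 * n%:R)).
    rewrite ler_wpM2r ?(ltW n0)// ler_wpM2l//.
    by apply: lerXn2r; rewrite ?nnegrE// divr_ge0// ltW.
  by rewrite le_eqVlt; apply/orP; left; apply/eqP; field; rewrite gt_eqF.
Qed.

Lemma gcdf_tails (R : realType) (e : R) : 0 < e ->
  exists M : R, 0 < M /\ forall y, M <= y -> 1 - gcdf y <= e /\ gcdf (- y) <= e.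
Proof.
move=> e0.
have /cvgrPdist_le/(_ e e0) [M1 [M1r hM1]] := @gcdf_cvgy R.
have /cvgrPdist_le/(_ e e0) [M2 [M2r hM2]] := @gcdf_cvgNy R.
exists (`|M1| + `|M2| + 1); split; first by rewrite ltr_wpDl// addr_ge0.
move=> y My; split.
  have /hM1 /= : M1 < y by have := ler_norm M1; have := normr_ge0 M2; lra.
  by rewrite ger0_norm// subr_ge0 gcdf_le1.
have /hM2 /= : - y < M2 by have := ler_norm (- M2); have := normr_ge0 M1; rewrite normrN; lra.
by rewrite sub0r normrN ger0_norm// gcdf_ge0.
Qed.

(** [N] is chosen before the dimension and the laws: in the theorem both vary with n. *)
Lemma cdf_cvg (R : realType) (H : nat) (y e : R) : (0 < H)%N -> 0 < e ->
  exists N : nat, forall (n p : nat) (mu : probability (vecT R p) R)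
    (Q : probability (arrT R p n) R),
  (N <= n)%N -> (N <= p)%N -> (0 < p)%N ->
  mu [set 0] = 0%E ->
  (forall (O : 'M[R]_p) (B : set 'cV[R]_p), orthogonal_mx O -> vborel B ->
    mu ((fun v => udir v) @^-1` B) = mu ((fun v => O *m udir v) @^-1` B)) ->
  (forall B : nat -> set 'cV[R]_p, (forall t, vborel (B t)) ->
    Q (cyl n B) = (\prod_(1 <= t < n.+1) mu (B t))%E) ->
  `|fine (Q [set x : arrT R p n | psum n H n x <= y]) - gcdf y| <= e.
Proof.
move=> H0 e0; pose g := gbound R; have g0 : 0 <= g by exact: gbound_ge0.
(* The error is split into six shares: two for the telescoping, one for the shift, one for the total
   time, two for the tails. *)
have e6 : 0 < e / 6 by rewrite divr_gt0.
pose z := e / (6 * (g + 1) + e).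
have zd : 0 < 6 * (g + 1) + e by rewrite addr_gt0// mulr_gt0// ltr_wpDl.
have z0 : 0 < z by rewrite divr_gt0.
have gz : g * z <= e / 6.
  rewrite /z mulrA ler_pdivrMr//; have := mulr_ge0 g0 (ltW e0); have := mulr_gt0 e0 e0; nra.
have [M [M0 tails]] := gcdf_tails e6.
pose K := 2 * g * (`|y| + z) + 1.
have yz0 : 0 <= `|y| + z by apply: addr_ge0 => //; exact: ltW.
have K1 : 1 <= K by rewrite /K lerDr; apply: mulr_ge0 => //; exact: mulr_ge0.
have K0 : 0 < K by exact: lt_le_trans K1.
(* The first bound pushes z / sqrt s0 beyond [M], into the tails; the second makes the excess s0 of
   the total time harmless. *)
pose s0 := Num.min ((z / M) ^+ 2) (e / (12 * K)).
have s00 : 0 < s0 by rewrite lt_min exprn_gt0 ?divr_gt0// mulr_gt0.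
have Ks0 : K * s0 <= e / 12.
  apply: (@le_trans _ _ (K * (e / (12 * K)))).
    by rewrite ler_wpM2l ?(ltW K0)// ge_min lexx orbT.
  by rewrite le_eqVlt; apply/orP; left; apply/eqP; field; rewrite gt_eqF.
have zs : M <= z / Num.sqrt s0.
  rewrite ler_pdivlMr ?sqrtr_gt0// mulrC -ler_pdivlMr//.
  have zM0 : 0 <= z / M by apply: divr_ge0; exact: ltW.
  rewrite -[leRHS](ger0_norm zM0) -sqrtr_sqr ler_wsqrtr//.
  by rewrite ge_min lexx.
have [tl1 tl2] := tails _ zs.
have [C0 _ _ _] := hconst_parts s00.
set C := hconst s0 in C0.
have C10 : 0 < C + 1 by rewrite ltr_wpDl.
pose eta := e / (6 * (C + 1)).
have eta0 : 0 < eta by rewrite divr_gt0// mulr_gt0.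
have Ceta : C * eta <= e / 6.
  rewrite /eta mulrA ler_pdivrMr ?mulr_gt0//; have := mulr_ge0 C0 (ltW e0); lra.
(* Once [dtot], its square and [tmax] are at most [kappa], the telescoping bound is at most [hconst]
   times eta + L kappa; the square needs kappa <= 1. *)
pose L := 2 + 6 / eta.
have L0 : 0 < L by rewrite addr_gt0// divr_gt0.
pose kappa := Num.min 1 (Num.min (e / (12 * K)) (e / (6 * (C + 1) * L))).
have k0 : 0 < kappa by rewrite !lt_min ltr01 !divr_gt0 ?mulr_gt0.
have k1 : kappa <= 1 by rewrite ge_min lexx.
have Kk : K * kappa <= e / 12.
  apply: (@le_trans _ _ (K * (e / (12 * K)))).
    by rewrite ler_wpM2l ?(ltW K0)// !ge_min lexx orbT.
  by rewrite le_eqVlt; apply/orP; left; apply/eqP; field; rewrite gt_eqF.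
have CLk : C * (L * kappa) <= e / 6.
  apply: (@le_trans _ _ ((C + 1) * (L * (e / (6 * (C + 1) * L))))).
    apply: ler_pM; rewrite ?mulr_ge0 ?lerDl ?(ltW L0) ?(ltW k0)//.
    by rewrite ler_wpM2l ?(ltW L0)// !ge_min lexx !orbT.
  by rewrite le_eqVlt; apply/orP; left; apply/eqP; field; rewrite !gt_eqF.
have [N HN] := remainder_small H k0.
exists N => n p mu Q Nn Np p0 mu0 mu_rot Q_prod.
have [Hn W1 W2 D1 T1] := HN n p Nn Np.
apply: (le_trans (cdf_bound p0 mu0 mu_rot Q_prod H0 Hn y z0 s00 eta0 W2)).
have D0 : 0 <= dtot R p n H by rewrite mulr_ge0// dev_ge0.
move: tl1 tl2 W1 D1 T1 D0; rewrite -/C -/g.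
move: (dtot R p n H) (tmax R n H) ((n - H)%:R^-1 : R) => D T W.
move: (gcdf (z / _)) (gcdf (- _)) => a b tl1 tl2 W1 D1 T1 D0.
have term1 : C * (D + (eta / 2 * (D + 1) + 3 / eta * (D ^+ 2 + T)) + T) <= e / 6 + e / 6.
  have : D + (eta / 2 * (D + 1) + 3 / eta * (D ^+ 2 + T)) + T <= eta + L * kappa.
    have D2 : D ^+ 2 <= kappa.
      by rewrite expr2; apply: (le_trans _ D1); rewrite ler_piMr//; exact: (le_trans D1 k1).
    have h1 : 3 / eta * (D ^+ 2 + T) <= 3 / eta * (2 * kappa).
      by rewrite ler_wpM2l ?divr_ge0 ?(ltW eta0)//; lra.
    have h2 : eta / 2 * (D + 1) <= eta / 2 * 2.
      by rewrite ler_wpM2l ?divr_ge0 ?(ltW eta0)//; lra.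
    have hL : L * kappa = 2 * kappa + 3 / eta * (2 * kappa) by rewrite /L; ring.
    rewrite hL; move: h1 h2 D1 T1; move: (3 / eta * _) (3 / eta * _) => u v; clear; lra.
  by move=> /(ler_wpM2l C0); rewrite mulrDr; lra.
have term2 : 2 * g * (`|y| + z) * (s0 + W) <= e / 12 + e / 12.
  apply: (@le_trans _ _ (K * (s0 + kappa))); last by rewrite mulrDr; lra.
  apply: (@le_trans _ _ (2 * g * (`|y| + z) * (s0 + kappa))).
    by apply: ler_wpM2l; [apply: mulr_ge0 => //; exact: mulr_ge0|rewrite lerD2l].
  by rewrite ler_wpM2r ?addr_ge0 ?(ltW s00) ?(ltW k0)// /K lerDl.
move: term1 term2 gz tl1 tl2; clear; lra.
Qed.

(** * From the sample space to the law of the array *)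

Section transfer_to_arrays.
Context (R : realType) (p n H : nat).

Lemma eq_TStat (U V : nat -> 'cV[R]_p) :
  (forall t, (1 <= t <= n)%N -> U t = V t) -> TStat H n U = TStat H n V.
Proof.
move=> UV; rewrite /TStat /Tstat; congr ((_ - _) / _).
apply: eq_big_nat => h /andP[h1 hH]; rewrite !frob_rmat; congr (_ * (_ * _)).
apply: eq_big_nat => t /andP[t1 t2]; apply: eq_big_nat => s /andP[s1 s2].
by rewrite !UV//; lia.
Qed.

Context d (T : measurableType d).

Lemma measurable_TStat (U : T -> nat -> 'cV[R]_p) :
  (forall t i, (1 <= t <= n)%N -> measurable_fun setT (fun w => U w t i ord0)) ->
  measurable_fun setT (fun w => TStat H n (U w)).
Proof.
(* Rows outside 1, ..., n do not affect the statistic; setting them to 0 makes every row measurable,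
   so sums are handled term by term without range conditions. *)
move=> mU; pose V w t := if (1 <= t <= n)%N then U w t else 0.
have mV t i : measurable_fun setT (fun w => V w t i ord0).
  rewrite /V; have [tn|tn] := boolP (1 <= t <= n)%N; first exact: mU.
  by under eq_fun do rewrite mxE; exact: measurable_cst.
rewrite (_ : (fun w => _) = fun w => TStat H n (V w)); last first.
  by apply/funext => w; apply: eq_TStat => t tn; rewrite /V tn.
have mdot s t : measurable_fun setT (fun w => dot (V w s) (V w t)).
  by apply: measurable_sum => i; exact: measurable_funM.
apply: measurable_funM => //; apply: measurable_funB => //.
apply: measurable_sum => h; apply: measurable_funM => //.
under eq_fun do rewrite frob_rmat.
apply: measurable_funM => //; apply: measurable_sum => t; apply: measurable_sum => s.
exact: measurable_funM.
Qed.

End transfer_to_arrays.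

Section array_law.
Context d (T : measurableType d) (R : realType) (P : probability T R) (p n : nat).
Variable X : nat -> T -> 'cV[R]_p.
Hypotheses (p_gt0 : (0 < p)%N) (n_gt0 : (0 < n)%N).
Hypotheses (iidX : iid_vectors P n X) (sphX : spherical_directions P (X 1%N)).

Let mX t : (1 <= t <= n)%N -> measurable_fun setT (X t : T -> vecT R p).
Proof. by move=> tn _ B mB; rewrite setTI; exact: iidX.1. Qed.

Definition array_of (w : T) : arrT R p n := fun t => X t w.

Lemma array_of_preimage B : array_of @^-1` (cyl n B) =
  \bigcap_(t in [set t | (1 <= t <= n)%N]) (X t @^-1` B t).
Proof. by []. Qed.

Lemma measurable_array_of : measurable_fun setT array_of.
Proof.
apply: (@measurability _ _ T (arrT R p n) setT _ (@cyls R p n)) => //.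
move=> _ [_ [B [mB ->]] <-]; rewrite setTI array_of_preimage.
apply: bigcap_measurable; first by exists 1%N => /=; rewrite n_gt0.
by move=> t tn; exact: iidX.1.
Qed.

Let array_mixin := isMeasurableFun.Build _ _ T (arrT R p n) array_of measurable_array_of.
Let array_pack : {mfun T >-> arrT R p n} := MeasurableFun.Pack (MeasurableFun.Class array_mixin).

Let mX1 : measurable_fun setT (X 1%N : T -> vecT R p).
Proof. by apply: mX; rewrite n_gt0. Qed.

Let entry_mixin := isMeasurableFun.Build _ _ T (vecT R p) (X 1%N : T -> vecT R p) mX1.
Let entry_pack : {mfun T >-> vecT R p} := MeasurableFun.Pack (MeasurableFun.Class entry_mixin).

Definition array_law : probability (arrT R p n) R := distribution P array_pack.
Definition entry_law : probability (vecT R p) R := distribution P entry_pack.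

Lemma array_law_prod (B : nat -> set 'cV[R]_p) : (forall t, vborel (B t)) ->
  array_law (cyl n B) = (\prod_(1 <= t < n.+1) entry_law (B t))%E.
Proof.
move=> mB; have [_ [prodX idX]] := iidX.
rewrite [LHS](prodX B mB); apply: eq_big_nat => t tn.
exact: idX.
Qed.

Lemma entry_law0 : entry_law [set 0] = 0%E.
Proof. exact: sphX.1. Qed.

Lemma entry_law_rot (O : 'M[R]_p) (B : set 'cV[R]_p) : orthogonal_mx O -> vborel B ->
  entry_law ((fun v => udir v) @^-1` B) = entry_law ((fun v => O *m udir v) @^-1` B).
Proof. exact: sphX.2. Qed.

Definition degenerate : set T := [set w | exists2 t, (1 <= t <= n)%N & X t w = 0].

Lemma degenerate_negligible : P.-negligible degenerate.
Proof.
have neg t : P.-negligible (if (1 <= t <= n)%N then X t @^-1` [set 0] else set0).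
  case: ifPn => tn; last exact: negligible_set0.
  apply/negligibleP; first by apply: (iidX.1 t tn); exact: vborel0.
  by apply: (etrans (iidX.2.2 t _ tn (vborel0 (R := R) (p := p)))); exact: sphX.1.
apply: negligibleS (negligible_bigcup neg).
by move=> w [t tn Xt0]; exists t => //=; rewrite tn.
Qed.

Lemma udir_sdir w t : ~ degenerate w -> (1 <= t <= n)%N ->
  udir (X t w) = sdir n t (array_of w).
Proof.
move=> ndeg tn; rewrite /sdir tn usphE//.
by apply/eqP => Xt0; apply: ndeg; exists t.
Qed.

Section fixed_lag.
Variable H : nat.
Hypotheses (H_gt0 : (0 < H)%N) (H_lt_n : (H < n)%N).

Lemma TStat_array w : ~ degenerate w ->
  TStat H n (fun t => udir (X t w)) = psum n H n (array_of w).
Proof.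
move=> ndeg; rewrite psumE// -TStat_altE//; last by move=> t _; exact: sdir_unit.
by apply: eq_TStat => t tn; exact: udir_sdir.
Qed.

Lemma TStat_alt_ae : {ae P, forall w,
  TStat H n (fun t => udir (X t w)) = TStat_alt H n (fun t => udir (X t w))}.
Proof.
apply: negligibleS degenerate_negligible => w /= neq; apply: contrapT => ndeg.
apply: neq; apply: TStat_altE => // t tn.
by rewrite udir_sdir//; exact: sdir_unit.
Qed.

Lemma TStat_law y :
  P [set w | TStat H n (fun t => udir (X t w)) <= y] =
  array_law [set x : arrT R p n | psum n H n x <= y].
Proof.
have mS : measurable_fun setT (psum n H n : arrT R p n -> R).
  by have [] := @bmf_psum R p n p_gt0 H n.
have mSX : measurable_fun setT (fun w => psum n H n (array_of w)).
  exact: (measurableT_comp mS measurable_array_of).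
have mT : measurable_fun setT (fun w => TStat H n (fun t => udir (X t w))).
  apply: measurable_TStat => t i tn.
  exact: (measurableT_comp (measurable_udir i) (mX tn)).
apply: (measure_eq_off_null degenerate_negligible (measurable_le_set y mT)
  (measurable_le_set y mSX)).
by move=> w /TStat_array /= ->.
Qed.

End fixed_lag.
End array_law.

Theorem theorem4 (R : realType) (d : measure_display) (T : measurableType d)
    (P : probability T R) (H : nat) (p : nat -> nat)
    (X : forall n : nat, nat -> T -> 'cV[R]_(p n)) :
  (0 < H)%N ->
  (forall n, (0 < p n)%N) ->
  (forall M : nat, \forall n \near \oo, (M <= p n)%N) ->
  (forall n, iid_vectors P n (X n)) ->
  (forall n, spherical_directions P (X n 1%N)) ->
  let U n t w := udir (X n t w) in
  (forall n, (H < n)%N ->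
     {ae P, forall w, TStat H n (U n ^~ w) = TStat_alt H n (U n ^~ w)}) /\
  (forall x : R,
     (fun n => P [set w | TStat H n (U n ^~ w) <= x]) @ \oo -->
       normal_prob 0 1 `]-oo, x]).
Proof.
move=> H0 p0 poo iidX sphX U; split.
  by move=> n Hn; exact: (TStat_alt_ae (p0 n) (iidX n) (sphX n) H0 Hn).
(* The array law takes the law of row 1 as the common one, hence n > 0; this and H < n hold
   eventually. *)
have law n (n0 : (0 < n)%N) : (H < n)%N -> forall y, P [set w | TStat H n (U n ^~ w) <= y] =
    array_law n0 (iidX n) [set x | psum n H n x <= y].
  by move=> nH y; rewrite (TStat_law (p0 n) n0 (iidX n) (sphX n) H0 nH).
move=> x; rewrite -gcdfE; apply/fine_cvgP; split.
  near=> n; have nH : (H < n)%N by near: n; exact: nbhs_infty_gt.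
  have n0 : (0 < n)%N by exact: leq_ltn_trans nH.
  rewrite (law n n0 nH) fin_num_measure//; apply: measurable_le_set.
  by have [] := @bmf_psum R (p n) n (p0 n) H n.
apply/cvgrPdist_le => e e0.
have [N HN] := cdf_cvg x H0 e0.
near=> n.
have nN : (N <= n)%N by near: n; exact: nbhs_infty_ge.
have nH : (H < n)%N by near: n; exact: nbhs_infty_gt.
have pN : (N <= p n)%N by near: n; exact: poo.
have n0 : (0 < n)%N by exact: leq_ltn_trans nH.
rewrite distrC /comp (law n n0 nH).
apply: (HN n (p n) (entry_law n0 (iidX n))) => //.
- exact: entry_law0.
- exact: entry_law_rot.
- exact: array_law_prod.
Unshelve. all: by end_near.
Qed.
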